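(* For every uncountable cardinal $\kappa$, the Banach lattice $L_1([0,1]^\kappa)$ is $1$-separably $\mathcal{BL}$-injective.
   Context: $[0,1]^\kappa$ is endowed with the product of the Lebesgue measures on each factor. Banach lattices are real; lattice homomorphisms are bounded linear operators commuting with the lattice operations. A Banach lattice $Z$ is $1$-separably $\mathcal{BL}$-injective if for every separable Banach lattice $Y$, every closed sublattice $X$ of $Y$ and every lattice homomorphism $T:X\to Z$, there exists a lattice homomorphism $\tilde T:Y\to Z$ extending $T$ with $\|\tilde T\|\leq\|T\|$. *)

(* Defs.v *)
From HB Require Import structures.
From mathcomp Require Import all_boot all_order all_algebra.
From mathcomp Require Import all_classical all_reals all_analysis.
From mathcomp Require Import measurable_realfun.
From mathcomp Require Import lra.
Set Implicit Arguments. Unset Strict Implicit. Unset Printing Implicit Defensive.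
Import Order.TTheory GRing.Theory Num.Def Num.Theory.
Import numFieldNormedType.Exports.
Local Open Scope classical_set_scope.
Local Open Scope ring_scope.

(* The order is a field of the mixin and not an [Order.POrder] instance: HB
   rejects a structure inheriting from both [CompleteNormedModule] and
   [Order.POrder], since no declared join of [Num.SemiNormedZmodule] and
   [Order.Preorder] lies below the existing [Num.NumDomain].
   In [vle_norm], [vsup x (- x)] is the modulus of [x]. *)
HB.mixin Record isBanachLattice (R : realType) V
    & CompleteNormedModule R V := {
  vle : rel V;
  vsup : V -> V -> V;
  vinf : V -> V -> V;
  vle_refl : reflexive vle;
  vle_anti : antisymmetric vle;
  vle_trans : transitive vle;
  vsup_le : forall x y z, vle (vsup x y) z = vle x z && vle y z;
  le_vinf : forall x y z, vle z (vinf x y) = vle z x && vle z y;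
  vleD2r : forall z x y, vle x y -> vle (x + z) (y + z);
  vscaler_ge0 : forall (a : R) x, 0 <= a -> vle 0 x -> vle 0 (a *: x);
  vle_norm : forall x y, vle (vsup x (- x)) (vsup y (- y)) -> `|x| <= `|y|
}.

#[short(type="banachLatticeType")]
HB.structure Definition BanachLattice (R : realType) :=
  {V of CompleteNormedModule R V & isBanachLattice R V}.

Lemma filterS4 T (F : set_system T) (FF : Filter F) (P Q U V W : set T) :
  (forall x, P x -> Q x -> U x -> V x -> W x) -> F P -> F Q -> F U -> F V -> F W.
Proof.
move=> PW FP FQ FU FV.
apply: filterS (filterI (filterI FP FQ) (filterI FU FV)).
by move=> x [[Px Qx] [Ux Vx]]; exact: PW.
Qed.

Section L1_space.
Context d (T : measurableType d) (R : realType).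
Variable mu : {measure set T -> \bar R}.
Local Notation L1 := (LspaceType1 mu).
Local Notation integrable f := (mu.-integrable setT (EFin \o (f : T -> R))).
Implicit Types f g h : L1.

HB.instance Definition _ := gen_eqMixin L1.
HB.instance Definition _ := gen_choiceMixin L1.

Lemma L1_measurable f : measurable_fun setT (f : T -> R).
Proof.
exact: (@measurable_funPT _ _ T (measurableTypeR R)
         (repr (LebesgueSpace.sort f : {mfun_ mu, T >-> measurableTypeR R}))).
Qed.

Lemma L1_integrable f : integrable f.
Proof.
apply/Lfun1_integrable; apply/andP; split.
  by rewrite inE /=; exact: L1_measurable.
by rewrite inE /=; exact: (Lebesgue_finite (s := f)).
Qed.

Lemma L1_eqP f g : f = g <-> f = g %[ae mu].
Proof.
split=> [->|fg]; first exact: ae_eq_refl.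
have : (LebesgueSpace.sort f) = (LebesgueSpace.sort g).
  by have /eqP := introT (ae_eqP _ _) fg; rewrite !reprK.
case: f {fg} => u [[pu]]; case: g => v [[pv]] /= uv.
by move: pu pv; rewrite uv => pu pv; rewrite (Prop_irrelevance pu pv).
Qed.

Section class_of.
Variables (u : T -> R) (iu : integrable u).

Let mu_ : @measurable_fun _ _ T (measurableTypeR R) setT u.
Proof. exact/measurable_EFinP/(measurable_int mu iu). Qed.

Let um : {mfun T >-> measurableTypeR R} :=
  HB.pack (u : T -> measurableTypeR R)
    (@isMeasurableFun.Build _ _ T (measurableTypeR R) u mu_).

Let uq : {mfun_ mu, T >-> measurableTypeR R} := (\pi um)%qT.

Let uqE : uq = u %[ae mu].
Proof.
have : (repr uq = um %[mod {mfun_ mu, T >-> measurableTypeR R}])%qT by rewrite reprK.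
by move=> /eqmodP /asboolP.
Qed.

Let iuq : integrable uq.
Proof.
have muq : measurable_fun setT (uq : T -> R).
  exact: (@measurable_funPT _ _ T (measurableTypeR R) (repr uq)).
apply/integrableP; split; first exact/measurable_EFinP.
have /integrableP[_] := iu; apply: le_lt_trans.
rewrite le_eqVlt (ae_eq_integral (fun x => `|(u x)%:E|%E)) ?eqxx//.
- by apply: measurableT_comp => //; exact/measurable_EFinP.
- by apply: measurableT_comp => //; exact/measurable_EFinP.
- by apply: filterS uqE => x /= + _ => ->.
Qed.

Let uq_finite : finite_norm mu 1 uq.
Proof.
by have /Lfun1_integrable := iuq; rewrite inE => /andP[_]; rewrite inE.
Qed.

Definition toL1 : L1 :=
  LebesgueSpace.Pack (LebesgueSpace.Class
    (isFinLebesgue.phant_Build (lexx 1%E) uq_finite)).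

Lemma toL1E : {ae mu, forall x, toL1 x = u x}.
Proof. by apply: filterS uqE => x /(_ I). Qed.

End class_of.

Lemma integrable_cst0 : integrable (cst 0).
Proof. exact: integrable0. Qed.

Lemma integrable_add f g : integrable (fun x => f x + g x).
Proof. by have := integrableD measurableT (L1_integrable f) (L1_integrable g). Qed.

Lemma integrable_opp f : integrable (fun x => - f x).
Proof. exact: integrableN (L1_integrable f). Qed.

Lemma integrable_scale (a : R) f : integrable (fun x => a * f x).
Proof. by have := integrableZl measurableT a (L1_integrable f). Qed.

Lemma integrable_norm f : integrable (fun x => `|f x|).
Proof. by have := integrable_abse (L1_integrable f). Qed.

Lemma integrable_max f g : integrable (fun x => Num.max (f x) (g x)).
Proof.
apply: (le_integrable measurableT _ _
  (integrableD measurableT (integrable_norm f) (integrable_norm g))).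
- by apply/measurable_EFinP; apply: measurable_maxr; exact: L1_measurable.
- move=> x _ /=; rewrite lee_fin [leRHS]ger0_norm ?addr_ge0//.
  by rewrite /Num.max; case: ifPn => _; rewrite ?lerDl ?lerDr.
Qed.

Lemma integrable_min f g : integrable (fun x => Num.min (f x) (g x)).
Proof.
apply: (le_integrable measurableT _ _
  (integrableD measurableT (integrable_norm f) (integrable_norm g))).
- by apply/measurable_EFinP; apply: measurable_minr; exact: L1_measurable.
- move=> x _ /=; rewrite lee_fin [leRHS]ger0_norm ?addr_ge0//.
  by rewrite /Num.min; case: ifPn => _; rewrite ?lerDl ?lerDr.
Qed.

Let zero := toL1 integrable_cst0.
Let add f g := toL1 (integrable_add f g).
Let opp f := toL1 (integrable_opp f).
Let scale a f := toL1 (integrable_scale a f).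

Let addE f g : {ae mu, forall x, add f g x = f x + g x}. Proof. exact: toL1E. Qed.
Let oppE f : {ae mu, forall x, opp f x = - f x}. Proof. exact: toL1E. Qed.
Let zeroE : {ae mu, forall x, zero x = 0}. Proof. exact: toL1E. Qed.
Let scaleE a f : {ae mu, forall x, scale a f x = a * f x}.
Proof. exact: toL1E. Qed.

Lemma L1P f g : {ae mu, forall x, f x = g x} -> f = g.
Proof. by move=> fg; apply/L1_eqP; apply: filterS fg => x ->. Qed.

Let addA : associative add.
Proof.
move=> f g h; apply: L1P.
move: (addE f (add g h)) (addE g h) (addE (add f g) h) (addE f g).
by apply: filterS4 => x -> -> -> ->; rewrite addrA.
Qed.

Let addC : commutative add.
Proof.
move=> f g; apply: L1P; move: (addE f g) (addE g f).
by apply: filterS2 => x -> ->; rewrite addrC.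
Qed.

Let add0 : left_id zero add.
Proof.
move=> f; apply: L1P; move: (addE zero f) zeroE.
by apply: filterS2 => x -> ->; rewrite add0r.
Qed.

Let addN : left_inverse zero opp add.
Proof.
move=> f; apply: L1P; move: (addE (opp f) f) zeroE (oppE f).
by apply: filterS3 => x -> -> ->; rewrite addNr.
Qed.

HB.instance Definition _ := GRing.isZmodule.Build L1 addA addC add0 addN.

Let scaleA a b f : scale a (scale b f) = scale (a * b) f.
Proof.
apply: L1P; move: (scaleE a (scale b f)) (scaleE b f) (scaleE (a * b) f).
by apply: filterS3 => x -> -> ->; rewrite mulrA.
Qed.

Let scale1 : left_id 1 scale.
Proof.
by move=> f; apply: L1P; apply: filterS (scaleE 1 f) => x ->; rewrite mul1r.
Qed.

Let scaleDr : right_distributive scale +%R.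
Proof.
move=> a f g; apply: L1P.
move: (scaleE a (add f g)) (addE f g) (addE (scale a f) (scale a g)).
move: (scaleE a f) (scaleE a g) => fE gE h1 h2 h3.
apply: filterS (filterI (filterI h1 (filterI h2 h3)) (filterI fE gE)).
by move=> x [[e1 [e2 e3]] [e4 e5]]; rewrite e1 e2 e3 e4 e5 mulrDr.
Qed.

Let scaleDl f : {morph scale^~ f : a b / a + b}.
Proof.
move=> a b; apply: L1P.
move: (scaleE (a + b) f) (scaleE a f) (scaleE b f) (addE (scale a f) (scale b f)).
by apply: filterS4 => x -> e1 e2 ->; rewrite e1 e2 mulrDl.
Qed.

HB.instance Definition _ :=
  GRing.Zmodule_isLmodule.Build R L1 scaleA scale1 scaleDr scaleDl.

Lemma L1_addE f g : {ae mu, forall x, (f + g) x = f x + g x}.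
Proof. exact: addE. Qed.

Lemma L1_oppE f : {ae mu, forall x, (- f) x = - f x}.
Proof. exact: oppE. Qed.

Lemma L1_0E : {ae mu, forall x, (0 : L1) x = 0}.
Proof. exact: zeroE. Qed.

Lemma L1_scaleE a f : {ae mu, forall x, (a *: f) x = a * f x}.
Proof. exact: scaleE. Qed.

Lemma L1_subE f g : {ae mu, forall x, (f - g) x = f x - g x}.
Proof. by move: (L1_addE f (- g)) (L1_oppE g); apply: filterS2 => x -> ->. Qed.

Let norm f : R := fine ('N[mu]_1[EFin \o f])%E.

Let normE f : (norm f)%:E = (\int[mu]_x `|(f x)%:E|)%E.
Proof.
rewrite /norm Lnorm1 fineK//.
have /integrableP[_ fy] := L1_integrable f.
by rewrite ge0_fin_numE// integral_ge0.
Qed.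

Let mnorm f : measurable_fun setT (fun x => `|(f x)%:E|%E).
Proof.
by apply: measurableT_comp => //; apply/measurable_EFinP; exact: L1_measurable.
Qed.

Let normD f g : norm (f + g) <= norm f + norm g.
Proof.
rewrite -lee_fin EFinD !normE -ge0_integralD//.
apply: ae_ge0_le_integral => //.
- by move=> x _; rewrite adde_ge0.
- exact: emeasurable_funD.
- by apply: filterS (L1_addE f g) => x -> _; rewrite EFinD lee_abs_add.
Qed.

Let normZ a f : norm (a *: f) = `|a| * norm f.
Proof.
apply: EFin_inj; rewrite EFinM !normE -ge0_integralZl//.
apply: ae_eq_integral => //; first exact: emeasurable_funM.
by apply: filterS (L1_scaleE a f) => x -> _; rewrite EFinM abseM.
Qed.

Let norm0 f : norm f = 0 -> f = 0.
Proof.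
move=> nf0; have := normE f; rewrite nf0 => /esym f0.
have mf : measurable_fun setT (EFin \o f) by apply/measurable_EFinP; exact: L1_measurable.
have := (ae_eq_integral_abs mu measurableT mf).1 f0.
move=> h; apply: L1P; move: h L1_0E.
by apply: filterS2 => x /(_ I) [->] ->.
Qed.

HB.instance Definition _ := Lmodule_isNormed.Build R L1 normD normZ norm0.

Lemma L1_normE f : `|f|%:E = (\int[mu]_x `|(f x)%:E|)%E.
Proof. exact: normE. Qed.


Let L1_seq_cvg (f_ : nat -> L1) :
  (forall n, `|f_ n.+1 - f_ n| <= 1 / (2 ^ n.+1)%:R) ->
  exists g, forall e : R, 0 < e -> \forall n \near \oo, `|g - f_ n| < e.
Proof.
move=> f_le.
pose h n x : \bar R := `|(f_ n.+1 x - f_ n x)%:E|%E.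
have mh n : measurable_fun setT (h n).
  apply: measurableT_comp => //; apply/measurable_EFinP.
  by apply: measurable_funB; exact: L1_measurable.
pose G x : \bar R := (\sum_(n <oo) h n x)%E.
have h0 n x : setT x -> (0 <= h n x)%E by rewrite /h.
have mG : measurable_fun setT G.
  by apply: (ge0_emeasurable_sum (P := xpredT)) => // k x _ _; exact: h0.
have G0 x : (0 <= G x)%E by apply: nneseries_ge0 => n _ _; exact: h0.
have iG : (\int[mu]_x G x <= 1)%E.
  rewrite /G integral_nneseries//.
  apply: le_trans (@epsilon_trick0 R 1 xpredT ler01).
  apply: lee_nneseries => [n _ _|n _]; first by apply: integral_ge0 => x; exact: h0.
  rewrite -[leRHS]/((1 / (2 ^ n.+1)%:R)%:E); move: (f_le n); rewrite -lee_fin.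
  apply: le_trans; rewrite L1_normE le_eqVlt (ae_eq_integral (h n)) ?eqxx//.
  by apply: filterS (L1_subE (f_ n.+1) (f_ n)) => x -> _.
have IG : mu.-integrable setT G.
  apply/integrableP; split => //.
  by under eq_integral do rewrite gee0_abs//; exact: le_lt_trans iG (ltry _).
have Gfin : {ae mu, forall x, G x \is a fin_num}.
  by apply: filterS (integrable_ae measurableT IG) => x /(_ I).
have psum x n : (\sum_(0 <= k < n) h k x <= G x)%E.
  by apply: nneseries_lim_ge => k _ _; exact: h0.
have hE n x : (\sum_(0 <= k < n) h k x)%E =
    ([normed series (telescope (fun k => f_ k x))] n)%:E.
  by rewrite /series /= -sumEFin.
have f_cvg x : G x \is a fin_num -> cvgn (fun n => f_ n x : R).
  move=> Gx.
  have : cvgn [normed series (telescope (fun k => f_ k x))].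
    apply: nondecreasing_is_cvgn.
      by apply: nondecreasing_series => n _ _; rewrite normr_ge0.
    exists (fine (G x)) => _ [n _ <-]; rewrite -lee_fin fineK// -hE; exact: psum.
  move=> /normed_cvg; rewrite telescopeK => c.
  rewrite (_ : (fun n => f_ n x) =
    (fun n => [sequence f_ n x - f_ 0%N x]_n n + f_ 0%N x)); last first.
    by apply/funext => n /=; rewrite subrK.
  by apply: is_cvgD => //; exact: is_cvg_cst.
pose F x : R := fine (limn_esup (fun n => (f_ n x)%:E)).
have f_F x : G x \is a fin_num -> (fun n => (f_ n x)%:E) @ \oo --> (F x)%:E.
  move=> /f_cvg /cvg_ex[l fl].
  have fl' : (fun n => (f_ n x)%:E) @ \oo --> l%:E by apply/cvg_EFin => //; exact: nearW.
  by rewrite /F (cvg_limn_einf_sup fl').2.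
have mf_ n : measurable_fun setT (fun x => (f_ n x)%:E).
  by apply/measurable_EFinP; exact: L1_measurable.
have mF : measurable_fun setT (EFin \o F).
  apply/measurable_EFinP; apply: (measurableT_comp (fine_measurable measurableT)).
  exact: measurable_fun_limn_esup.
have f_dom : {ae mu, forall x, forall n, setT x ->
    (`|(f_ n x)%:E| <= `|(f_ 0%N x)%:E| + G x)%E}.
  apply: aeW => x n _; rewrite (eq_sum_telescope (fun n => f_ n x) n) EFinD.
  apply: le_trans (lee_abs_add _ _) _; rewrite leeD2l//.
  apply: le_trans (psum x n); rewrite hE lee_fin.
  by rewrite /series /=; exact: ler_norm_sum.
have idom : mu.-integrable setT (fun x => (`|(f_ 0%N x)%:E| + G x)%E).
  by apply: integrableD => //; exact: integrable_abse (L1_integrable _).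
have f_F' : {ae mu, forall x, setT x -> (fun n => (f_ n x)%:E) @ \oo --> (F x)%:E}.
  by apply: filterS Gfin => x Gx _; exact: f_F.
have [iF cF _] := dominated_convergence measurableT mf_ mF f_F' idom f_dom.
exists (toL1 iF) => e e0.
have gE n : (`|toL1 iF - f_ n|%:E = \int[mu]_x `|(f_ n x)%:E - (F x)%:E|)%E.
  rewrite L1_normE; apply: ae_eq_integral => //.
  - by apply: measurableT_comp => //; exact: emeasurable_funB.
  - move: (toL1E iF) (L1_subE (toL1 iF) (f_ n)).
    by apply: filterS2 => x e1 + _ => ->; rewrite e1 -!EFinB !abse_EFin distrC.
have cF0 : (fun n => `|toL1 iF - f_ n|) @ \oo --> (0 : R).
  apply: (fine_cvg (f := fun n => `|toL1 iF - f_ n|%:E)).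
  by rewrite (funext gE).
move/cvgrPdist_lt : cF0 => /(_ e e0); apply: filterS => n.
by rewrite sub0r normrN normr_id.
Qed.

Let L1_complete (F : set_system L1) : ProperFilter F -> cauchy F -> cvg F.
Proof.
move=> FF cF.
have /choice[y Fy] (n : nat) : exists y, F (ball y (1 / (2 ^ n.+3)%:R : R)).
  apply: ((cauchyP F).1 cF (1 / (2 ^ n.+3)%:R)).
  by rewrite divr_gt0// ltr0n expn_gt0.
have y_le n : `|y n.+1 - y n| <= 1 / (2 ^ n.+1)%:R.
  have [z [/= z1 z2]] := filter_ex (filterI (Fy n) (Fy n.+1)).
  move: z1 z2; rewrite -!ball_normE /= => z1 z2.
  have -> : y n.+1 - y n = (y n.+1 - z) - (y n - z) by rewrite opprB addrA subrK.
  apply: le_trans (ler_normB _ _) _.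
  apply: le_trans (lerD (ltW z2) (ltW z1)) _.
  rewrite (expnS 2 n.+3) (expnS 2 n.+2) (expnS 2 n.+1) !natrM.
  have : 0 < (2 ^ n.+1)%:R :> R by rewrite ltr0n expn_gt0.
  move: (_%:R : R) => t t0.
  rewrite !invfM !div1r; have : 0 < t^-1 by rewrite invr_gt0.
  by move: (t^-1) => u u0; lra.
have [g gy] := L1_seq_cvg y_le.
apply/cvg_ex; exists g; apply/cvgrPdist_lt => e e0.
have e20 : 0 < e / 2 by rewrite divr_gt0.
have [n [/= gn ne]] : exists n, `|g - y n| < e / 2 /\ 1 / (2 ^ n.+3)%:R < e / 2.
  have [n [/= gn ne]] := filter_ex (filterI (gy _ e20)
    (near_infty_natSinv_expn_lt (PosNum e20))).
  exists n; split => //; apply: le_lt_trans ne.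
  rewrite !div1r lef_pV2 ?posrE ?ltr0n ?expn_gt0 ?exprn_gt0//.
  by rewrite -natrX ler_nat leq_exp2l// -addn3 leq_addr.
apply: filterS (Fy n) => z; rewrite -ball_normE /= => zn.
rewrite -(subrK (y n) g) -addrA (le_lt_trans (ler_normD _ _))//.
by rewrite (splitr e) ltrD// (lt_trans zn).
Qed.

HB.instance Definition _ := Uniform_isComplete.Build L1 L1_complete.

Let le f g : bool := `[< {ae mu, forall x, f x <= g x} >].
Let sup f g := toL1 (integrable_max f g).
Let inf f g := toL1 (integrable_min f g).

Let supE f g : {ae mu, forall x, sup f g x = Num.max (f x) (g x)}.
Proof. exact: toL1E. Qed.

Let infE f g : {ae mu, forall x, inf f g x = Num.min (f x) (g x)}.
Proof. exact: toL1E. Qed.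

Let le_refl : reflexive le.
Proof. by move=> f; apply/asboolP; apply: aeW. Qed.

Let le_anti : antisymmetric le.
Proof.
move=> f g /andP[/asboolP fg /asboolP gf]; apply: L1P.
by move: fg gf; apply: filterS2 => x fg gf; apply/le_anti/andP.
Qed.

Let le_trans : transitive le.
Proof.
move=> g f h /asboolP fg /asboolP gh; apply/asboolP.
by move: fg gh; apply: filterS2 => x; exact: le_trans.
Qed.

Let sup_le f g h : le (sup f g) h = le f h && le g h.
Proof.
apply/asboolP/andP => [H|[/asboolP fh /asboolP gh]].
  split; apply/asboolP; move: H (supE f g); apply: filterS2 => x + e;
    by rewrite e ge_max => /andP[].
by move: fh gh (supE f g); apply: filterS3 => x fh gh ->; rewrite ge_max fh.
Qed.

Let le_inf f g h : le h (inf f g) = le h f && le h g.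
Proof.
apply/asboolP/andP => [H|[/asboolP fh /asboolP gh]].
  split; apply/asboolP; move: H (infE f g); apply: filterS2 => x + e;
    by rewrite e le_min => /andP[].
by move: fh gh (infE f g); apply: filterS3 => x fh gh ->; rewrite le_min fh.
Qed.

Let leD2r h f g : le f g -> le (f + h) (g + h).
Proof.
move=> /asboolP fg; apply/asboolP; move: fg (L1_addE f h) (L1_addE g h).
by apply: filterS3 => x fg -> ->; rewrite lerD2r.
Qed.

Let scaler_ge0 (a : R) f : 0 <= a -> le 0 f -> le 0 (a *: f).
Proof.
move=> a0 /asboolP f0; apply/asboolP; move: f0 (L1_scaleE a f) L1_0E.
by apply: filterS3 => x + -> z; rewrite z => f0; rewrite mulr_ge0.
Qed.

Let le_norm f g : le (sup f (- f)) (sup g (- g)) -> `|f| <= `|g|.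
Proof.
move=> /asboolP fg; rewrite -lee_fin !L1_normE; apply: ae_ge0_le_integral => //.
apply: filterS (filterI (filterI (supE f (- f)) (supE g (- g)))
  (filterI fg (filterI (L1_oppE f) (L1_oppE g)))).
move=> x [[e1 e2] [+ [e3 e4]]] _; rewrite e1 e2 e3 e4.
have maxN (r : R) : Num.max r (- r) = `|r| by case: (ger0P r) => r0;
    [rewrite max_l|rewrite max_r]; lra.
by rewrite !maxN.
Qed.

HB.instance Definition _ := isBanachLattice.Build R L1
  le_refl le_anti le_trans sup_le le_inf leD2r scaler_ge0 le_norm.

Lemma L1_vleP f g : vle f g <-> {ae mu, forall x, f x <= g x}.
Proof. by split=> [/asboolP|fg]; last exact/asboolP. Qed.

Lemma L1_vsupE f g : {ae mu, forall x, vsup f g x = Num.max (f x) (g x)}.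
Proof. exact: supE. Qed.

Lemma L1_vinfE f g : {ae mu, forall x, vinf f g x = Num.min (f x) (g x)}.
Proof. exact: infE. Qed.

End L1_space.

Definition separable (T : topologicalType) :=
  exists2 D : set T, countable D & dense D.

Section lattice_homomorphisms.
Variables (R : realType) (Y Z : banachLatticeType R).
Implicit Types (X : set Y) (T : Y -> Z).

Definition sublattice X : Prop :=
  [/\ X 0,
      forall (a : R) x y, X x -> X y -> X (a *: x + y),
      forall x y, X x -> X y -> X (vsup x y)
    & forall x y, X x -> X y -> X (vinf x y)].

(* A map X -> Z is represented by any T : Y -> Z, of which only the values on
   X matter. *)
Definition lattice_hom X T : Prop :=
  [/\ forall (a : R) x y, X x -> X y -> T (a *: x + y) = a *: T x + T y,
      forall x y, X x -> X y -> T (vsup x y) = vsup (T x) (T y),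
      forall x y, X x -> X y -> T (vinf x y) = vinf (T x) (T y)
    & exists M : R, forall x, X x -> `|T x| <= M * `|x|].

Definition op_norm X T : \bar R :=
  ereal_sup [set `|T x|%:E | x in X `&` [set x | `|x| <= 1]].

End lattice_homomorphisms.

Definition one_separably_BL_injective (R : realType) (Z : banachLatticeType R) :
    Prop :=
  forall Y : banachLatticeType R, separable Y ->
  forall X : set Y, sublattice X -> closed X ->
  forall T : Y -> Z, lattice_hom X T ->
  exists T' : Y -> Z,
    [/\ lattice_hom [set: Y] T', forall x, X x -> T' x = T x
      & (op_norm [set: Y] T' <= op_norm X T)%E].

Section cube.
Variables (R : realType) (I : Type).

Definition unit_itv : Type := {x : R | 0 <= x <= 1}.

Definition unit_itv0 : unit_itv := exist _ 0 (introT andP (conj (lexx 0) ler01)).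

HB.instance Definition _ := gen_eqMixin unit_itv.
HB.instance Definition _ := gen_choiceMixin unit_itv.
HB.instance Definition _ := isPointed.Build unit_itv unit_itv0.

Definition coordinate_sets : set (set (I -> unit_itv)) :=
  [set C | exists (i : I) (B : set R),
     measurable B /\ C = [set x | B (sval (x i))]].

(* [0,1]^I with the product sigma-algebra. *)
Definition cube := g_sigma_algebraType coordinate_sets.

(* The product of the Lebesgue measures is the measure on the product
   sigma-algebra which takes the product value on every measurable rectangle
   restricting finitely many (distinct) coordinates; n = 0 gives total mass 1. *)
Definition is_product_lebesgue (mu : {measure set cube -> \bar R}) : Prop :=
  forall (n : nat) (i : 'I_n -> I) (B : 'I_n -> set R),
    injective i -> (forall k, measurable (B k)) ->
    mu [set x : cube | forall k, B k (sval (x (i k)))] =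
    (\prod_(k < n) lebesgue_measure (B k `&` [set t | (0 <= t <= 1)%R]))%E.

End cube.

(* Main.v *)
Require Import Defs.
From HB Require Import structures.
From mathcomp Require Import all_boot all_order all_algebra.
From mathcomp Require Import all_classical all_reals all_analysis.
From mathcomp Require Import measurable_realfun lra.
Set Implicit Arguments. Unset Strict Implicit. Unset Printing Implicit Defensive.
Import Order.TTheory GRing.Theory Num.Def Num.Theory.
Import numFieldNormedType.Exports.
Local Open Scope classical_set_scope.
Local Open Scope ring_scope.

(** Let T : X -> L1 be a lattice homomorphism of norm C. The functional
    x |-> int T x on X extends to a positive functional psi on Y with
    psi y <= C |y| for y >= 0, and psi may be taken to live on the band
    generated by X. In the L1-space defined by psi, every y >= 0 is then close
    to an element which on each piece of a finite partition coincides with an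
    element of X. Band projections are not available in Y, so pieces are
    encoded by the positive functionals phi <= psi they induce on Y: by
    Hahn-Banach, phi splits as phi0 + phi1 with phi1 (u^-) = 0 and
    phi0 (u^+) = 0, which separates where u >= 0 from where u <= 0.
    Along with each phi one constructs a measurable A with
    phi x = int_A T x for x in X. When phi splits, phi1 is transported to a
    functional on L1, hence has the form x |-> int_A g T x with 0 <= g <= 1.
    As g and a dense sequence of the T x only depend on countably many
    coordinates, there is a fresh coordinate t_j, independent of them, and
    A1 = A /\ {t_j <= g} satisfies int_A1 T x = int_A g T x.
    Splitting repeatedly along a sequence of elements u yields a binary tree of
    pairs (phi, A). If y is approximated by x_s on the leaves s of a finite
    subtree, then T' y is approximated by the sum of the 1_(A_s) T x_s, and the
    compatibility of phi_s and A_s makes this isometric for psi. *)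

(** * Banach lattices *)

Section riesz_space.
Variables (R : realType) (V : banachLatticeType R).
Implicit Types (x y z : V) (a : R).

Definition vabs x : V := vsup x (- x).
Definition vpos x : V := vsup x 0.

Lemma vlexx x : vle x x. Proof. exact: vle_refl. Qed.

Lemma vle_le_trans x y z : vle x y -> vle y z -> vle x z.
Proof. exact: vle_trans. Qed.

Lemma vleDr z x y : vle x y -> vle (x + z) (y + z).
Proof. exact: vleD2r. Qed.

Lemma vle_addr0 x y : vle x y = vle 0 (y - x).
Proof.
apply/idP/idP => [/(vleDr (- x))|/(vleDr x)]; first by rewrite subrr.
by rewrite add0r subrK.
Qed.

Lemma vleD x y z w : vle x y -> vle z w -> vle (x + z) (y + w).
Proof.
move=> xy zw; apply: vle_le_trans (vleDr z xy) _.
by rewrite ![y + _]addrC; exact: vleDr.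
Qed.

Lemma vleN x y : vle x y -> vle (- y) (- x).
Proof. by rewrite vle_addr0 [vle (- y) _]vle_addr0 opprK addrC. Qed.

Lemma vleB x y z w : vle x y -> vle w z -> vle (x - z) (y - w).
Proof. by move=> xy /vleN; exact: vleD. Qed.

Lemma vleZ a x y : 0 <= a -> vle x y -> vle (a *: x) (a *: y).
Proof.
by move=> a0; rewrite vle_addr0 [vle (a *: _) _]vle_addr0 -scalerBr; exact: vscaler_ge0.
Qed.

Lemma vleZr x (a b : R) : vle 0 x -> a <= b -> vle (a *: x) (b *: x).
Proof.
move=> x0 ab; rewrite vle_addr0 -scalerBl; apply: vscaler_ge0 => //.
by rewrite subr_ge0.
Qed.

Lemma vaddr_ge0 x y : vle 0 x -> vle 0 y -> vle 0 (x + y).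
Proof. by move=> x0 y0; rewrite -[0]addr0; exact: vleD. Qed.

Lemma vsum_ge0 (f : nat -> V) n :
  (forall i, vle 0 (f i)) -> vle 0 (\sum_(i < n) f i).
Proof. by move=> f0; elim/big_ind: _ => //; [exact: vlexx|exact: vaddr_ge0]. Qed.

Lemma vsupl x y : vle x (vsup x y).
Proof. by have := vlexx (vsup x y); rewrite vsup_le => /andP[]. Qed.

Lemma vsupr x y : vle y (vsup x y).
Proof. by have := vlexx (vsup x y); rewrite vsup_le => /andP[]. Qed.

Lemma vsup_lub x y z : vle x z -> vle y z -> vle (vsup x y) z.
Proof. by rewrite vsup_le => -> ->. Qed.

Lemma vinfl x y : vle (vinf x y) x.
Proof. by have := vlexx (vinf x y); rewrite le_vinf => /andP[]. Qed.

Lemma vinfr x y : vle (vinf x y) y.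
Proof. by have := vlexx (vinf x y); rewrite le_vinf => /andP[]. Qed.

Lemma vinf_glb x y z : vle z x -> vle z y -> vle z (vinf x y).
Proof. by rewrite le_vinf => -> ->. Qed.

Lemma vle_antiP x y : vle x y -> vle y x -> x = y.
Proof. by move=> xy yx; apply: vle_anti; rewrite xy. Qed.

Lemma vsupC x y : vsup x y = vsup y x.
Proof. by apply: vle_antiP; apply: vsup_lub; (exact: vsupl || exact: vsupr). Qed.

Lemma vsupDr x y z : vsup x y + z = vsup (x + z) (y + z).
Proof.
apply: vle_antiP.
  rewrite -(subrK z (vsup (x + z) (y + z))); apply: vleDr.
  by apply: vsup_lub; rewrite -[X in vle X _](addrK z);
    apply: vleDr; [exact: vsupl|exact: vsupr].
by apply: vsup_lub; apply: vleDr; [exact: vsupl|exact: vsupr].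
Qed.

Lemma vinfE x y : vinf x y = x + y - vsup x y.
Proof.
apply: vle_antiP.
  rewrite -[vinf x y](addrK (vsup x y)); apply: vleDr.
  rewrite addrC vsupDr; apply: vsup_lub.
    by apply: vleD; [exact: vlexx|exact: vinfr].
  by rewrite addrC; apply: vleD; [exact: vinfl|exact: vlexx].
apply: vinf_glb; first rewrite -[X in vle _ X](addrK y).
  by apply: vleB; [exact: vlexx|exact: vsupr].
rewrite [x + y]addrC -[X in vle _ X](addrK x).
by apply: vleB; [exact: vlexx|exact: vsupl].
Qed.

Lemma vinfC x y : vinf x y = vinf y x.
Proof. by rewrite !vinfE (vsupC y) (addrC y). Qed.

Lemma vinf_leS x y z w : vle x y -> vle z w -> vle (vinf x z) (vinf y w).
Proof.
move=> xy zw; apply: vinf_glb; first exact: vle_le_trans (vinfl _ _) xy.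
exact: vle_le_trans (vinfr _ _) zw.
Qed.

Lemma vsup_leS x y z w : vle x y -> vle z w -> vle (vsup x z) (vsup y w).
Proof.
move=> xy zw; apply: vsup_lub; first exact: vle_le_trans xy (vsupl _ _).
exact: vle_le_trans zw (vsupr _ _).
Qed.

Lemma vinf_idPl x y : vle x y -> vinf x y = x.
Proof.
by move=> xy; apply: vle_antiP; [exact: vinfl|apply: vinf_glb => //; exact: vlexx].
Qed.

Lemma vsupZ a x y : 0 <= a -> a *: vsup x y = vsup (a *: x) (a *: y).
Proof.
rewrite le_eqVlt => /predU1P[<-|a0].
  by rewrite !scale0r; apply: vle_antiP; [exact: vsupl|apply: vsup_lub; exact: vlexx].
apply: vle_antiP; last first.
  by apply: vsup_lub; apply: vleZ (ltW a0) _; [exact: vsupl|exact: vsupr].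
rewrite -[X in vle _ X](scalerKV (lt0r_neq0 a0)); apply: vleZ; first exact: ltW.
have a'0 : 0 <= a^-1 by rewrite invr_ge0 ltW.
by apply: vsup_lub; rewrite -[X in vle X _](scalerK (lt0r_neq0 a0));
  apply: vleZ => //; [exact: vsupl|exact: vsupr].
Qed.

Lemma vpos_ge0 x : vle 0 (vpos x). Proof. exact: vsupr. Qed.

Lemma vle_vpos x : vle x (vpos x). Proof. exact: vsupl. Qed.

Lemma vposS x y : vle x y -> vle (vpos x) (vpos y).
Proof. by move=> xy; apply: vsup_leS => //; exact: vlexx. Qed.

Lemma vpos_id x : vle 0 x -> vpos x = x.
Proof.
by move=> x0; apply: vle_antiP; [apply: vsup_lub => //; exact: vlexx|exact: vsupl].
Qed.

Lemma vposZ a x : 0 <= a -> vpos (a *: x) = a *: vpos x.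
Proof. by move=> a0; rewrite /vpos vsupZ// scaler0. Qed.

Lemma vposD_le x y : vle (vpos (x + y)) (vpos x + vpos y).
Proof.
apply: vsup_lub; first by apply: vleD; exact: vle_vpos.
by apply: vaddr_ge0; exact: vpos_ge0.
Qed.

Lemma vposB x : x = vpos x - vpos (- x).
Proof.
suff -> : vpos (- x) = vpos x - x by rewrite opprB addrC subrK.
by rewrite /vpos vsupDr subrr add0r vsupC.
Qed.

Lemma vposE x y : vpos (x - y) = x - vinf x y.
Proof.
by rewrite vinfE opprB opprD addrCA addNKr vsupDr subrr.
Qed.

Lemma vle_abs x : vle x (vabs x). Proof. exact: vsupl. Qed.

Lemma vleN_abs x : vle (- x) (vabs x). Proof. exact: vsupr. Qed.

Lemma vabs_lub x y : vle x y -> vle (- x) y -> vle (vabs x) y.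
Proof. exact: vsup_lub. Qed.

Lemma vabs_ge0 x : vle 0 (vabs x).
Proof.
have : vle 0 ((2^-1 : R) *: (vabs x + vabs x)).
  apply: vscaler_ge0; first by rewrite invr_ge0.
  by rewrite -(subrr x); apply: vleD; [exact: vle_abs|exact: vleN_abs].
by rewrite scalerDr -scalerDl (_ : 2^-1 + 2^-1 = 1) ?scale1r//; lra.
Qed.

Lemma vabsN x : vabs (- x) = vabs x.
Proof. by rewrite /vabs opprK vsupC. Qed.

Lemma vabs_distC x y : vabs (x - y) = vabs (y - x).
Proof. by rewrite -vabsN opprB. Qed.

Lemma vabs_id x : vle 0 x -> vabs x = x.
Proof.
move=> x0; apply: vle_antiP; last exact: vle_abs.
apply: vabs_lub; first exact: vlexx.
by apply: vle_le_trans (x0); rewrite -[X in vle _ X]oppr0; apply: (vleN x0).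
Qed.

Lemma vabs0 : vabs (0 : V) = 0.
Proof. by apply: vabs_id; exact: vlexx. Qed.

Lemma vabs_vabs x : vabs (vabs x) = vabs x.
Proof. by apply: vabs_id; exact: vabs_ge0. Qed.

Lemma vabsD x y : vle (vabs (x + y)) (vabs x + vabs y).
Proof.
apply: vabs_lub; first by apply: vleD; exact: vle_abs.
by rewrite opprD; apply: vleD; exact: vleN_abs.
Qed.

Lemma vabsZ a x : vabs (a *: x) = `|a| *: vabs x.
Proof.
have [a0|a0] := ger0P a; first by rewrite /vabs vsupZ// scalerN.
rewrite -[LHS]vabsN -scaleNr /vabs vsupZ ?scalerN//.
by rewrite oppr_ge0 ltW.
Qed.

Lemma vabsDZ a x y x' y' :
  vle (vabs ((a *: x + y) - (a *: x' + y')))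
      (`|a| *: vabs (x - x') + vabs (y - y')).
Proof. by rewrite opprD addrACA -scalerBr -vabsZ; exact: vabsD. Qed.

Lemma vabs_sup x y x' y' :
  vle (vabs (vsup x y - vsup x' y')) (vabs (x - x') + vabs (y - y')).
Proof.
have H (u v u' v' : V) :
    vle (vsup u v) ((vabs (u - u') + vabs (v - v')) + vsup u' v').
  apply: vsup_lub.
  - rewrite -[X in vle X _](subrK u'); apply: vleD; last exact: vsupl.
    apply: vle_le_trans (vle_abs _) _; rewrite -[X in vle X _]addr0.
    by apply: vleD; [exact: vlexx|exact: vabs_ge0].
  - rewrite -[X in vle X _](subrK v'); apply: vleD; last exact: vsupr.
    apply: vle_le_trans (vle_abs _) _; rewrite -[X in vle X _]add0r.
    by apply: vleD; [exact: vabs_ge0|exact: vlexx].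
apply: vabs_lub.
  by have := vleDr (- vsup x' y') (H x y x' y'); rewrite addrK.
rewrite opprB (vabs_distC x) (vabs_distC y).
by have := vleDr (- vsup x y) (H x' y' x y); rewrite addrK.
Qed.

Lemma vpos_le_abs x : vle (vpos x) (vabs x).
Proof. by apply: vsup_lub; [exact: vle_abs|exact: vabs_ge0]. Qed.

Lemma norm_vle_abs x y : vle (vabs x) (vabs y) -> `|x| <= `|y|.
Proof. exact: vle_norm. Qed.

Lemma norm_vabs x : `|vabs x| = `|x|.
Proof.
by apply/le_anti/andP; split; apply: norm_vle_abs; rewrite vabs_vabs; exact: vlexx.
Qed.

Lemma norm_vle x y : vle 0 x -> vle x y -> `|x| <= `|y|.
Proof.
move=> x0 xy; apply: norm_vle_abs.
by rewrite !vabs_id//; exact: vle_le_trans xy.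
Qed.

Lemma norm_vpos x : `|vpos x| <= `|x|.
Proof.
by rewrite -[leRHS]norm_vabs; apply: norm_vle; [exact: vpos_ge0|exact: vpos_le_abs].
Qed.

Lemma norm_vpos_sub x y : `|vpos x - vpos y| <= `|x - y|.
Proof.
rewrite -[leLHS]norm_vabs -[leRHS]norm_vabs; apply: norm_vle; first exact: vabs_ge0.
by apply: vle_le_trans (vabs_sup _ _ _ _) _; rewrite subrr vabs0 addr0; exact: vlexx.
Qed.

(** Moving [vinf x z], then [y], to the other side reduces the claim to bounds on [w] that follow
    from positivity. This is what makes [p] subadditive in [band_functional]. *)
Lemma vinfD_le x y z : vle 0 x -> vle 0 y -> vle 0 z ->
  vle (vinf x (y + z)) (vinf x y + vinf x z).
Proof.
move=> x0 y0 z0; set w := vinf x (y + z).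
have wB (u v t : V) : vle (u - t) v -> vle u (v + t).
  by move=> /(vleDr t); rewrite subrK.
have wB' (u v t : V) : vle u (v + t) -> vle (u - t) v.
  by move=> /(vleDr (- t)); rewrite addrK.
apply: (wB); apply: vinf_glb; apply: (wB').
  rewrite -[X in vle X _]addr0; apply: vleD; [exact: vinfl|exact: vinf_glb].
rewrite addrC; apply: (wB); apply: vinf_glb; apply: (wB').
  rewrite -[X in vle X _]addr0; apply: vleD => //; exact: vinfl.
by rewrite addrC; exact: vinfr.
Qed.

End riesz_space.

(** * The Hahn-Banach theorem *)

Section mazur_orlicz.
Variables (R : realType) (V : lmodType R).

Lemma inf_image_le (S : Type) (C : set S) (f : S -> R) m s :
  (forall t, C t -> m <= f t) -> C s -> inf (f @` C) <= f s.
Proof.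
move=> mf Cs; apply: ge_inf; last by exists s.
by exists m => _ [t Ct <-]; exact: mf.
Qed.

Lemma le_inf_image (S : Type) (C : set S) (f : S -> R) m s :
  C s -> (forall t, C t -> m <= f t) -> m <= inf (f @` C).
Proof.
move=> Cs mf; apply: lb_le_inf; first by exists (f s), s.
by move=> _ [t Ct <-]; exact: mf.
Qed.

Definition linear_fun (f : V -> R) :=
  forall (a : R) x y, f (a *: x + y) = a * f x + f y.

Definition sublinear (p : V -> R) :=
  (forall x y, p (x + y) <= p x + p y) /\
  (forall (a : R) x, 0 <= a -> p (a *: x) = a * p x).

Lemma sublinear0 p : sublinear p -> p 0 = 0.
Proof. by move=> [_ /(_ 0 0 (lexx 0))]; rewrite scale0r mul0r. Qed.

Lemma sublinearN p x : sublinear p -> - p (- x) <= p x.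
Proof.
move=> sp; have := sp.1 x (- x); rewrite subrr sublinear0// => H; lra.
Qed.

(** The missing inequality is the hypothesis for [a^-1] at [a *: x]; the case [a = 0] is
    [p 0 = 0]. *)
Lemma sublinear_pos (p : V -> R) :
  (forall x y, p (x + y) <= p x + p y) -> p 0 = 0 ->
  (forall (a : R) x, 0 < a -> p (a *: x) <= a * p x) -> sublinear p.
Proof.
move=> pD p0 pZ; split=> // a x; rewrite le_eqVlt => /predU1P[<-|a0].
  by rewrite scale0r mul0r.
apply/le_anti; rewrite pZ//=.
have a'0 : 0 < a^-1 by rewrite invr_gt0.
have := pZ _ (a *: x) a'0; rewrite scalerA mulVf ?gt_eqF// scale1r.
by rewrite mulrC ler_pdivlMr// mulrC.
Qed.

Section perturbation.
Variables (W : lmodType R) (C : set W) (f : W -> V) (b : W -> R) (p : V -> R).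
Hypothesis C0 : C 0.
Hypothesis CD : forall (a : R) s t, 0 <= a -> C s -> C t ->
  [/\ C (a *: s + t), f (a *: s + t) = a *: f s + f t
    & b (a *: s + t) = a * b s + b t].
Hypothesis sp : sublinear p.
Hypothesis bp : forall s, C s -> b s <= p (f s).

(** The infimum [q] absorbs the constraints [b s <= l (f s)] into the sublinear bound: evaluating at
    [- f s] shows that every linear [l <= q] satisfies them. By [bp] it stays above [- p (- x)], so
    the real [inf] is a genuine infimum. *)
Let g x s := p (x + f s) - b s.
Let q x := inf (g x @` C).

Let gE x s : C s -> - p (- x) <= g x s.
Proof.
move=> Cs; have := sp.1 (x + f s) (- x); have := bp Cs.
by rewrite addrC addrA addNr add0r /g => h1 h2; lra.
Qed.

Let q_le x s : C s -> q x <= g x s.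
Proof. by move=> Cs; apply: inf_image_le Cs; exact: gE. Qed.

Let f0 : f 0 = 0.
Proof.
have [_ + _] := CD ler01 C0 C0; rewrite !scale1r addr0 => /eqP.
by rewrite eq_sym -subr_eq0 addrK => /eqP.
Qed.

Let b0 : b 0 = 0.
Proof. by have [_ _] := CD ler01 C0 C0; rewrite !scale1r addr0 => H; lra. Qed.

Lemma sublinear_perturb : exists q : V -> R,
  [/\ sublinear q, forall x, q x <= p x & forall s, C s -> q (- f s) <= - b s].
Proof.
exists q; split; last first.
- move=> s Cs; apply: le_trans (q_le _ Cs) _.
  by rewrite /g addNr sublinear0// add0r.
- by move=> x; apply: le_trans (q_le _ C0) _; rewrite /g f0 b0 addr0 subr0.
- apply: sublinear_pos.
  + move=> x y; rewrite -lerBlDr; apply: le_inf_image C0 _ => s Cs.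
    rewrite lerBlDr -lerBlDl; apply: le_inf_image C0 _ => t Ct.
    have [Cst fst bst] := CD ler01 Cs Ct.
    rewrite !scale1r mul1r in Cst fst bst.
    rewrite lerBlDl; apply: le_trans (q_le _ Cst) _; rewrite /g fst bst addrACA.
    by have := sp.1 (x + f s) (y + f t) => h; lra.
  + apply/le_anti/andP; split.
      by apply: le_trans (q_le _ C0) _; rewrite /g f0 b0 addr0 subr0 sublinear0.
    by apply: le_inf_image C0 _ => s Cs; rewrite /g add0r subr_ge0 bp.
  + move=> a x a0; rewrite mulrC -ler_pdivrMr//; apply: le_inf_image C0 _ => s Cs.
    have [Cas fas bas] := CD (ltW a0) Cs C0.
    rewrite addr0 f0 b0 !addr0 in Cas fas bas.
    rewrite ler_pdivrMr//; apply: le_trans (q_le _ Cas) _.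
    by rewrite /g fas bas -scalerDr (sp.2 _ _ (ltW a0)) mulrBl ![_ * a]mulrC.
Qed.

End perturbation.

Lemma sublinear_minimal (p : V -> R) : sublinear p -> exists q : V -> R,
  [/\ sublinear q, forall x, q x <= p x &
    forall r, sublinear r -> (forall x, r x <= q x) -> r = q].
Proof.
move=> sp.
pose S := {q : V -> R | sublinear q /\ forall x, q x <= p x}.
pose rel_ge (q r : S) : bool := `[< forall x, sval r x <= sval q x >].
have [||||q qmin] := @Zorn S rel_ge.
- by move=> q; apply/asboolP => x.
- move=> q r s /asboolP qr /asboolP rs; apply/asboolP => x.
  exact: le_trans (rs x) (qr x).
- move=> [q qP] [r rP] /asboolP/= qr /asboolP/= rq; apply: eq_exist.
  by apply/funext => x; apply/le_anti; rewrite qr rq.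
- move=> A totA.
  have [A0|/set0P[q0 Aq0]] := eqVneq A set0.
    by exists (exist _ p (conj sp (fun x => lexx _))) => s; rewrite A0.
  pose r x := inf ((fun q : S => sval q x) @` A).
  have lb x (q : S) : - p (- x) <= sval q x.
    have [sq qp] := svalP q; have := sublinearN x sq; have := qp (- x).
    by move=> h1 h2; lra.
  have r_le x q : A q -> r x <= sval q x.
    by move=> Aq; apply: (inf_image_le (f := fun q : S => sval q x) _ Aq) => s _; exact: lb.
  have sr : sublinear r.
    apply: sublinear_pos.
    + move=> x y; rewrite -lerBlDr; apply: (le_inf_image Aq0) _ => s As.
      rewrite lerBlDr -lerBlDl; apply: (le_inf_image Aq0) _ => t At.
      rewrite lerBlDl.
      (* Both arguments can be evaluated at the smaller of [s] and [t]. *)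
      have [/asboolP st|/asboolP ts] := totA _ _ As At.
        apply: le_trans (r_le _ _ At) _; apply: le_trans ((svalP t).1.1 _ _) _.
        by rewrite lerD2r.
      apply: le_trans (r_le _ _ As) _; apply: le_trans ((svalP s).1.1 _ _) _.
      by rewrite lerD2l.
    + apply/le_anti/andP; split.
        by apply: le_trans (r_le _ _ Aq0) _; rewrite (sublinear0 (svalP q0).1).
      by apply: (le_inf_image Aq0) _ => s _; rewrite (sublinear0 (svalP s).1).
    + move=> a x a0; rewrite mulrC -ler_pdivrMr//; apply: (le_inf_image Aq0) _ => s As.
      rewrite ler_pdivrMr//; apply: le_trans (r_le _ _ As) _.
      by rewrite ((svalP s).1.2 _ _ (ltW a0)) mulrC.
  have rp x : r x <= p x by apply: le_trans (r_le _ _ Aq0) _; exact: (svalP q0).2.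
  exists (exist _ r (conj sr rp)) => s As; apply/asboolP => x; exact: r_le.
- exists (sval q); split; [exact: (svalP q).1|exact: (svalP q).2|].
  move=> r sr rq.
  have rp x : r x <= p x by apply: le_trans (rq x) _; exact: (svalP q).2.
  by rewrite -(qmin (exist _ r (conj sr rp)) (introT (asboolP _) rq)).
Qed.

(** A minimal sublinear functional is odd, and an odd sublinear functional is linear. *)
Lemma hahn_banach (p : V -> R) : sublinear p ->
  exists l : V -> R, linear_fun l /\ forall x, l x <= p x.
Proof.
move=> sp; have [q [sq qp qmin]] := sublinear_minimal sp.
have qN v : q (- v) = - q v.
  apply/le_anti/andP; split; last by have := sublinearN (- v) sq; rewrite opprK.
  (* Perturbing [q] along the ray of [v] gives [r <= q] with [r (- v) <= - q v]; minimality forces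
     [r = q]. *)
  have [|||r [sr rq]] := @sublinear_perturb R^o [set t | 0 <= t]
    (fun t => t *: v) (fun t => t * q v) q _ _ sq.
  - exact: lexx.
  - move=> a s t a0 s0 t0; split => /=; first by rewrite addr_ge0// mulr_ge0.
    + by rewrite scalerDl scalerA.
    + by rewrite mulrDl mulrA.
  - by move=> t t0; rewrite sq.2.
  by move=> /(_ 1 ler01); rewrite scale1r mul1r (qmin r).
exists q; split=> // a x y.
have qD u v : q (u + v) = q u + q v.
  apply/le_anti; rewrite sq.1/=.
  by have := sq.1 (u + v) (- v); rewrite addrK qN => h; lra.
rewrite qD; congr (_ + _); have [a0|a0] := leP 0 a; first exact: sq.2.
rewrite -[a]opprK scaleNr qN sq.2 ?mulNr//; by rewrite oppr_ge0 ltW.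
Qed.

(** The lower bound is indexed by an abstract cone so that one statement covers three uses:
    extending from a sublattice, prescribing a value along a ray, and transporting a functional
    along [T]. *)
Lemma mazur_orlicz (W : lmodType R) (C : set W) (f : W -> V) (b : W -> R)
    (p : V -> R) :
  C 0 ->
  (forall (a : R) s t, 0 <= a -> C s -> C t ->
    [/\ C (a *: s + t), f (a *: s + t) = a *: f s + f t
      & b (a *: s + t) = a * b s + b t]) ->
  sublinear p -> (forall s, C s -> b s <= p (f s)) ->
  exists l : V -> R,
    [/\ linear_fun l, forall x, l x <= p x & forall s, C s -> b s <= l (f s)].
Proof.
move=> C0 CD sp bp; have [q [sq qp qb]] := sublinear_perturb C0 CD sp bp.
have [l [ll lq]] := hahn_banach sq.
exists l; split=> // [x|s Cs]; first exact: le_trans (lq x) (qp x).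
rewrite -lerN2; apply: le_trans (qb _ Cs); apply: le_trans (lq _).
have := ll (-1) 0 0; have := ll 1 (- f s) (f s).
by rewrite scale1r !addNr scaleN1r oppr0 addr0 => h1 h2; lra.
Qed.

End mazur_orlicz.

(** * A coordinate independent of countably many functions *)

Section coordinates.
Variables (R : realType) (I : Type).
Local Notation Omega := (cube R I).
Implicit Types (J : set I) (i j : I).

Definition cube_coord j (x : Omega) : R := sval (x j).

Definition coord_sets J : set (set Omega) :=
  [set C | exists2 j, J j & exists2 B, measurable B & C = cube_coord j @^-1` B].

Lemma measurable_coord_preimage j (B : set R) :
  measurable B -> measurable (cube_coord j @^-1` B).
Proof. by move=> mB; apply: sub_sigma_algebra; exists j, B. Qed.

Lemma coord_sets_measurable J : <<s coord_sets J >> `<=` @measurable _ Omega.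
Proof.
apply: smallest_sub; first exact: sigma_algebra_measurable.
by move=> _ [j _ [B mB ->]]; exact: measurable_coord_preimage.
Qed.

Lemma coord_setsS J J' : J `<=` J' -> <<s coord_sets J >> `<=` <<s coord_sets J' >>.
Proof.
move=> JJ'; apply: smallest_sub; first exact: smallest_sigma_algebra.
by move=> C [j Jj HC]; apply: sub_sigma_algebra; exists j => //; exact: JJ'.
Qed.

(** The sets that depend on countably many coordinates form a sigma-algebra containing the
    generators. *)
Lemma measurable_countable_coords (C : set Omega) : measurable C ->
  exists2 J, countable J & <<s coord_sets J >> C.
Proof.
pose P := [set C : set Omega | exists2 J, countable J & <<s coord_sets J >> C].
suff : @measurable _ Omega `<=` P by exact.
apply: smallest_sub; first split.
- by exists set0; [exact: countable0|exact: sigma_algebra0].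
- move=> A [J cJ JA]; exists J => //.
  by apply: sigma_algebraCD.
- move=> A HA; have /choice[J_ HJ] n : exists J,
      countable J /\ <<s coord_sets J >> (A n).
    by have [J cJ JA] := HA n; exists J.
  exists (\bigcup_n J_ n).
    by apply: bigcup_countable => // n _; exact: (HJ n).1.
  apply: sigma_algebra_bigcup => n; apply: coord_setsS (HJ n).2.
  exact: bigcup_sup.
- move=> _ [i [B [mB ->]]]; exists [set i]; first exact: countable1.
  by apply: sub_sigma_algebra; exists i => //; exists B.
Qed.

(** [{classic I}] supplies the decidable equality on the arbitrary type [I] that list membership
    needs. *)
Definition cylinder (L : seq {classic I}) (B : I -> set R) : set Omega :=
  [set x | forall i : {classic I}, i \in L -> B i (cube_coord i x)].

Definition cylinders J : set (set Omega) :=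
  [set C | exists L : seq {classic I}, (forall i : {classic I}, i \in L -> J i) /\
    exists2 B, (forall i, measurable (B i)) & C = cylinder L B].

Lemma cylinder_bigcap L B :
  cylinder L B = \bigcap_(i in [set` L]) cube_coord i @^-1` B i.
Proof. by apply/seteqP; split=> x Bx i; exact: Bx. Qed.

Lemma cylinders_coord J :
  cylinders J `<=` <<s coord_sets J >>.
Proof.
move=> _ [L [LJ [B mB ->]]]; rewrite cylinder_bigcap.
pose GT := g_sigma_algebraType (coord_sets J).
apply: (@fin_bigcap_measurable _ GT) => // i Li.
by apply: sub_sigma_algebra; exists i; [exact: LJ|exists (B i)].
Qed.

Lemma coord_cylinders J : coord_sets J `<=` cylinders J.
Proof.
move=> _ [j Jj [B mB ->]]; exists [:: j : {classic I}]; split.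
  by move=> i; rewrite mem_seq1 => /eqP ->.
exists (fun=> B) => //; apply/seteqP; split=> x /= Bx.
  by move=> i; rewrite mem_seq1 => /eqP ->.
by apply: (Bx j); rewrite mem_seq1.
Qed.

Lemma sigma_cylinders J : <<s cylinders J >> = <<s coord_sets J >>.
Proof.
apply/seteqP; split; apply: smallest_sub; try exact: smallest_sigma_algebra.
  exact: cylinders_coord.
by move=> C /coord_cylinders; exact: sub_sigma_algebra.
Qed.

Lemma setI_cylinders J : setI_closed (cylinders J).
Proof.
move=> _ _ [L [LJ [B mB ->]]] [L' [LJ' [B' mB' ->]]].
exists (L ++ L'); split.
  by move=> i; rewrite mem_cat => /orP[/LJ|/LJ'].
exists (fun i : {classic I} => (if i \in L then B i else setT) `&`
    (if i \in L' then B' i else setT)).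
  by move=> i; apply: measurableI; case: ifP.
apply/seteqP; split=> x /=.
  by move=> [Bx B'x] i _; split; case: ifP => // Li; [exact: Bx|exact: B'x].
move=> H; split=> i Li; have := H i; rewrite mem_cat Li ?orbT => /(_ isT) [];
  by rewrite ?Li.
Qed.

Variable mu : {measure set Omega -> \bar R}.
Hypothesis mu_product : is_product_lebesgue mu.

Lemma mu_cylinder (L : seq {classic I}) B : uniq L -> (forall i, measurable (B i)) ->
  mu (cylinder L B) =
  (\prod_(i <- L) lebesgue_measure (B i `&` [set t | (0 <= t <= 1)%R]))%E.
Proof.
move=> uL mB.
have := @mu_product (size L) (tnth (in_tuple L)) (fun k => B (tnth (in_tuple L) k)).
rewrite (big_tnth _ _ L) => <- //.
- congr (mu _); apply/seteqP; split=> x /= Bx.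
    by move=> k; apply: Bx; exact: mem_tnth.
  by move=> i /(@tnthP _ _ (in_tuple L))[k ->]; exact: Bx.
- exact: (elimT (tuple_uniqP (in_tuple L)) uL).
Qed.

Lemma mu_setT : mu setT = 1%E.
Proof.
have := @mu_cylinder [::] (fun=> setT) isT (fun=> measurableT).
by rewrite big_nil => <-; congr (mu _); apply/seteqP.
Qed.

Lemma mu_coord j (D : set R) : measurable D ->
  mu (cube_coord j @^-1` D) = lebesgue_measure (D `&` [set t | (0 <= t <= 1)%R]).
Proof.
move=> mD; have := @mu_cylinder [:: j : {classic I}] (fun=> D) isT (fun=> mD).
rewrite big_seq1 => <-; congr (mu _); apply/seteqP; split=> x /= Dx.
  by move=> i; rewrite mem_seq1 => /eqP ->.
by apply: (Dx j); rewrite mem_seq1.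
Qed.

Lemma mu_coord_fin j (D : set R) : measurable D -> mu (cube_coord j @^-1` D) \is a fin_num.
Proof.
move=> mD; rewrite ge0_fin_numE//; apply: (@le_lt_trans _ _ 1%E); last exact: ltry.
rewrite -mu_setT; apply: le_measure; rewrite ?inE//.
exact: measurable_coord_preimage.
Qed.

(** By uniqueness of measures on a pi-system, it suffices to compare two finite measures, the mass
    inside [E] and [mu] scaled by [mu E], on the cylinders over [J]; there [E] contributes one more
    factor to the product. *)
Lemma coord_independent J j C (D : set R) : ~ J j -> <<s coord_sets J >> C ->
  measurable D -> mu (C `&` cube_coord j @^-1` D) = (mu C * mu (cube_coord j @^-1` D))%E.
Proof.
move=> nJj; rewrite -sigma_cylinders => JC mD.
pose E := cube_coord j @^-1` D.
have mE : measurable E := measurable_coord_preimage j mD.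
have r0 : 0 <= fine (mu E) by exact: fine_ge0.
rewrite muleC -[mu E]fineK ?mu_coord_fin//.
apply: (@g_sigma_algebra_measure_unique _ R Omega (cylinders J) _ (fun=> setT) _ _
  (mrestr mu mE) (mscale (NngNum r0) mu)) => //.
- by move=> X /cylinders_coord; exact: coord_sets_measurable.
- move=> _; exists [::]; split=> //; exists (fun=> setT) => //.
  by apply/seteqP.
- by rewrite bigcup_const//; exists 0%N.
- exact: setI_cylinders.
- move=> _ [L [LJ [B mB ->]]].
  rewrite -[LHS]/(mu (cylinder L B `&` E))
    -[RHS]/((fine (mu E))%:E * mu (cylinder L B))%E.
  rewrite fineK ?mu_coord_fin//.
  (* The product formula only applies to distinct coordinates. *)
  have undup_cyl : cylinder L B = cylinder (undup L) B.
    by apply/seteqP; split=> x Bx i Li; apply: Bx; rewrite mem_undup in Li *.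
  (* Overwriting [B] at [j] is harmless, since [j] lies outside [J] and hence is not in [L]. *)
  pose B' (i : {classic I}) : set R := if i == j then D else B i.
  have -> : cylinder L B `&` E = cylinder ((j : {classic I}) :: undup L) B'.
    rewrite undup_cyl; apply/seteqP; split=> x /=.
      move=> [Bx Dx] i; rewrite in_cons /B'; case: eqP => [-> _|_ /=].
        exact: Dx.
      exact: Bx.
    move=> H; split; last by have := H j; rewrite in_cons eqxx /B' eqxx; exact.
    move=> i Li; have := H i; rewrite in_cons Li orbT /B'.
    case: eqP => [ij|_]; last exact.
    by case: nJj; rewrite -ij; apply: LJ; rewrite -mem_undup.
  rewrite mu_cylinder; last 2 first.
  + rewrite /= undup_uniq andbT mem_undup; apply/negP => /LJ; exact: nJj.
  + by move=> i; rewrite /B'; case: ifP.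
  rewrite big_cons /B' eqxx -(mu_coord j mD) undup_cyl mu_cylinder ?undup_uniq//.
  congr (_ * _)%E; apply: eq_big_seq => i; rewrite mem_undup => Li.
  by case: eqP => // ij; case: nJj; rewrite -ij; exact: LJ.
- by move=> k; rewrite -[X in (X < _)%E]/(mu (setT `&` E)) setTI ltey_eq mu_coord_fin.
Qed.

End coordinates.

(** Independence says that the law of the pair is the product of the laws; Fubini for that product
    then integrates out [Y] first. *)
Lemma integral_independent d d1 d2 (T : measurableType d)
    (S1 : measurableType d1) (S2 : measurableType d2) (R : realType)
    (P : probability T R) (X : {mfun T >-> S1}) (Y : {mfun T >-> S2})
    (h : S1 * S2 -> \bar R) :
  (forall A B, measurable A -> measurable B ->
    P (X @^-1` A `&` Y @^-1` B) = (P (X @^-1` A) * P (Y @^-1` B))%E) ->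
  measurable_fun setT h -> P.-integrable setT (fun x => h (X x, Y x)) ->
  (\int[P]_x h (X x, Y x) = \int[P]_x \int[distribution P Y]_t h (X x, t))%E.
Proof.
move=> XY mh ih.
pose XYf x := (X x, Y x).
have mXY : measurable_fun setT XYf by exact: measurable_fun_pair.
pose Z : {mfun T >-> (S1 * S2)%type} :=
  HB.pack XYf (@isMeasurableFun.Build _ _ T _ XYf mXY).
have PE : forall A, measurable A ->
    (distribution P X \x distribution P Y)%E A = distribution P Z A.
  by apply: product_measure_unique => A B mA mB /=; rewrite -XY.
have iZ : (distribution P Z).-integrable setT h.
  exact: (integrable_pushforward mXY mh ih measurableT).
have iXY : (distribution P X \x distribution P Y)%E.-integrable setT h.
  apply/integrableP; split=> //; move/integrableP : iZ => [_].
  suff -> : (\int[(distribution P X \x distribution P Y)]_x `|h x| =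
    \int[distribution P Z]_x `|h x|)%E by [].
  by apply: eq_measure_integral => A mA _; exact: PE.
transitivity (\int[distribution P Z]_z h z)%E.
  exact/esym/(integral_pushforward mXY mh ih measurableT).
transitivity (\int[(distribution P X \x distribution P Y)]_z h z)%E.
  by apply: eq_measure_integral => A mA _; exact/esym/PE.
rewrite -integral12_prod_meas1//.
have mX : measurable_fun setT X by exact: measurable_funPT.
have mF := measurable_fubini_F iXY.
apply: (integral_pushforward mX mF _ measurableT).
apply/integrableP; split; first exact: measurableT_comp.
have /integrableP[_] := integrable_fubini_F iXY; apply: le_lt_trans.
rewrite (ge0_integral_pushforward mX _ measurableT) => [||x _].
- exact: lexx.
- exact: measurableT_comp.
- exact: abse_ge0.
Qed.

Section unit_mass.
Context d (T : measurableType d) (R : realType) (mu : {measure set T -> \bar R}).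
Hypothesis mu1 : mu setT = 1%E.

Let P := mu : set T -> \bar R.

HB.instance Definition _ := Measure.on P.

HB.instance Definition _ := Measure_isProbability.Build _ _ _ P mu1.

Lemma unit_mass_probability : exists Q : probability T R, Q = mu :> (set T -> \bar R).
Proof. by exists P. Qed.
End unit_mass.

Section fresh.
Variables (R : realType) (I : Type).
Local Notation Omega := (cube R I).
Local Notation sub_cube J := (g_sigma_algebraType (@coord_sets R I J)).

(** The rational superlevel sets determine measurability, and each involves countably many
    coordinates. Allowing any larger [J'] lets several functions share one set of coordinates. *)
Lemma measurable_fun_countable_coords (f : Omega -> R) : measurable_fun setT f ->
  exists2 J, countable J & forall J', J `<=` J' ->
    measurable_fun setT (f : sub_cube J' -> R).
Proof.
move=> mf.
have /choice[J_ HJ] (q : rat) : exists J, countable J /\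
    <<s coord_sets J >> (f @^-1` `]ratr q, +oo[%classic).
  have [|J cJ HJ] := @measurable_countable_coords R I (f @^-1` `]ratr q, +oo[%classic).
    by rewrite -[_ @^-1` _]setTI; exact: mf.
  by exists J.
exists (\bigcup_q J_ q).
  by apply: bigcup_countable => // q _; exact: (HJ q).1.
move=> J' JJ'; apply: (measurability _ (RGenOInfty.measurableE R)) => //.
move=> /= _ [_ [x ->] <-]; rewrite setTI.
have -> : f @^-1` `]x, +oo[%classic =
    \bigcup_(q : rat) (if x < ratr q then f @^-1` `]ratr q, +oo[%classic else set0).
  apply/seteqP; split=> t /=.
    rewrite in_itv/= andbT => xf; have [q] := rat_in_itvoo xf.
    rewrite in_itv/= => /andP[xq qf]; exists q => //; rewrite xq /=.
    by rewrite in_itv/= qf.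
  move=> [q _]; case: ifP => // xq /=; rewrite !in_itv/= !andbT.
  exact: lt_trans.
apply: (@bigcupT_measurable_rat _ (sub_cube J')) => q; case: ifP => // _.
by apply: coord_setsS (HJ q).2 => i Ji; apply: JJ'; exists q.
Qed.

Variable mu : {measure set Omega -> \bar R}.
Hypothesis mu_product : is_product_lebesgue mu.
Hypothesis I_uncountable : ~ countable [set: I].

Lemma mu_coord_le j (c : R) : 0 <= c <= 1 ->
  mu (cube_coord j @^-1` [set t | t <= c]) = c%:E.
Proof.
move=> /andP[c0 c1].
have -> : [set t : R | t <= c] = `]-oo, c]%classic.
  by apply/seteqP; split=> t /=; rewrite in_itv.
rewrite mu_coord//.
rewrite (_ : _ `&` _ = `[0, c]%classic).
  rewrite lebesgue_measure_itv/= lte_fin; case: ltP => [|c0']; first by rewrite sube0.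
  by congr EFin; apply/le_anti; rewrite c0 c0'.
apply/seteqP; split=> t /=; rewrite !in_itv/=; first by move=> [-> /andP[->]].
by move=> /andP[-> tc]; split => //=; apply: le_trans c1.
Qed.

(** The set is [t_j <= g] for a fresh coordinate [t_j]: given the coordinates in [J], its
    conditional probability is [g], because [t_j] is uniform on the unit interval and [g] takes its
    values there. *)
Lemma fresh_set (f_ : nat -> Omega -> R) (g : Omega -> R) :
  (forall n, mu.-integrable setT (EFin \o f_ n)) ->
  measurable_fun setT g -> (forall x, 0 <= g x <= 1) ->
  exists2 B, measurable B &
    forall n, (\int[mu]_(x in B) (f_ n x)%:E = \int[mu]_x (f_ n x * g x)%:E)%E.
Proof.
move=> if_ mg g01.
have mf_ n : measurable_fun setT (f_ n).
  exact/measurable_EFinP/measurable_int/if_.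
have [Jg cJg HJg] := measurable_fun_countable_coords mg.
have /choice[Jf HJf] n : exists J, countable J /\ forall J', J `<=` J' ->
    measurable_fun setT (f_ n : sub_cube J' -> R).
  by have [J cJ HJ] := measurable_fun_countable_coords (mf_ n); exists J.
(* [None] stands for [g] and [Some n] for [f_ n]. *)
pose J := \bigcup_(o : option nat) oapp Jf Jg o.
have cJ : countable J.
  by apply: bigcup_countable => // -[n|] _ //=; exact: (HJf n).1.
have [j nJj] : exists j, ~ J j.
  apply: contra_notP I_uncountable => /forallNP H.
  by apply: sub_countable cJ; apply: subset_card_le => i _; apply: contrapT; exact: H.
have mgJ : measurable_fun setT (g : sub_cube J -> R).
  by apply: HJg => i Ji; exists None.
have mfJ n : measurable_fun setT (f_ n : sub_cube J -> R).
  by apply: (HJf n).2 => i Ji; exists (Some n).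
have [P PE] := unit_mass_probability (mu_setT mu_product).
(* The identity onto the coarser sigma-algebra plays the role of the projection to the coordinates
   in [J]. *)
have mid : measurable_fun setT (id : Omega -> sub_cube J).
  by move=> _ A mA; rewrite setTI; exact: coord_sets_measurable mA.
pose X : {mfun Omega >-> sub_cube J} :=
  HB.pack (id : Omega -> sub_cube J)
    (@isMeasurableFun.Build _ _ Omega (sub_cube J) _ mid).
have mj : measurable_fun setT (cube_coord j : Omega -> measurableTypeR R).
  by move=> _ A mA; rewrite setTI; exact: measurable_coord_preimage.
pose Y : {mfun Omega >-> measurableTypeR R} :=
  HB.pack (cube_coord j : Omega -> measurableTypeR R)
    (@isMeasurableFun.Build _ _ Omega (measurableTypeR R) _ mj).
pose B := [set x | cube_coord j x <= g x].
have mB : measurable B.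
  by rewrite -[B]setTI; apply: (@measurable_fun_le _ _ _ _ (cube_coord j) g).
exists B => // n.
pose C := [set w : sub_cube J * measurableTypeR R | (w.2 : R) <= g w.1].
have mC : measurable C.
  rewrite -[C]setTI; apply: measurable_fun_le => //.
  exact: (measurableT_comp mgJ measurable_fst).
pose h (z : sub_cube J * measurableTypeR R) : \bar R := (f_ n z.1 * \1_C z)%:E.
have mh : measurable_fun setT h.
  apply/measurable_EFinP; apply: measurable_funM; last exact: measurable_indic.
  exact: (measurableT_comp (mfJ n) measurable_fst).
have XY A D : measurable A -> measurable D ->
    P (X @^-1` A `&` Y @^-1` D) = (P (X @^-1` A) * P (Y @^-1` D))%E.
  by move=> mA mD; rewrite PE; exact: (coord_independent mu_product nJj).
have ih : P.-integrable setT (fun x => h (X x, Y x)).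
  rewrite PE; apply: le_integrable (if_ n) => //.
    apply/measurable_EFinP; apply: measurable_funM => //; exact: measurable_indic.
  move=> x _; rewrite lee_fin normrM indicE; case: (_ \in _);
    by rewrite ?normr1 ?normr0 ?mulr1 ?mulr0.
have := integral_independent XY mh ih; rewrite PE => E.
transitivity (\int[mu]_x h (X x, Y x))%E.
  rewrite integral_mkcond; apply: eq_integral => x _.
  rewrite patchE /h indicE /=.
  have -> : ((X x, Y x) \in C) = (x \in B) by apply/idP/idP; rewrite !inE.
  by case: (x \in B); rewrite ?mulr1 ?mulr0.
rewrite E; apply: eq_integral => x _.
pose Cx : set (measurableTypeR R) := [set t : R | t <= g x].
have mCx : measurable Cx.
  have -> : Cx = `]-oo, g x]%classic by apply/seteqP; split=> t /=; rewrite in_itv.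
  exact: measurable_itv.
transitivity (\int[distribution P Y]_t ((f_ n x)%:E * (\1_Cx t)%:E))%E.
  by apply: eq_integral => t _; rewrite /h EFinM /= !indicE; congr (_ * (_%:R)%:E)%E;
    congr nat_of_bool; apply/idP/idP; rewrite !inE.
pose Q : probability (measurableTypeR R) R := distribution P Y.
rewrite (@integralZl _ _ _ Q _ measurableT _ (integrable_indic Q mCx)).
rewrite (@integral_indic _ _ _ Q _ measurableT _ mCx) setIT EFinM; congr (_ * _)%E.
rewrite -[LHS]/((P : set Omega -> \bar R) (cube_coord j @^-1` Cx)) PE; exact: mu_coord_le.
Qed.

End fresh.

(** * Integration over a set and the dual of L1 *)

Section L1_integral.
Context d (T : measurableType d) (R : realType) (mu : {measure set T -> \bar R}).
Local Notation L1 := (LspaceType1 mu).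
Implicit Types (f g : L1) (A B C : set T).

Definition integral_on A (f : L1) : R := fine (\int[mu]_(x in A) (f x)%:E)%E.

Lemma L1_integrable_on A f : measurable A -> mu.-integrable A (fun x => (f x)%:E).
Proof. by move=> mA; apply: integrableS (L1_integrable f). Qed.

Lemma integral_onE A f : measurable A ->
  (integral_on A f)%:E = (\int[mu]_(x in A) (f x)%:E)%E.
Proof.
move=> mA; rewrite fineK//; apply: integrable_fin_num => //.
exact: L1_integrable_on.
Qed.

Lemma L1_measurable_on A f : measurable_fun A (fun x => (f x)%:E).
Proof. by apply: measurable_funTS; apply/measurable_EFinP; exact: L1_measurable. Qed.

Lemma integral_on_linear A : measurable A -> linear_fun (integral_on A).
Proof.
move=> mA a f g; apply: EFin_inj; rewrite EFinD EFinM !integral_onE//.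
have mf h := @L1_measurable_on A h.
transitivity (\int[mu]_(x in A) (a%:E * (f x)%:E + (g x)%:E))%E.
  apply: ae_eq_integral => //.
    by apply: emeasurable_funD => //; exact: emeasurable_funM.
  move: (L1_addE (a *: f) g) (L1_scaleE a f); apply: filterS2 => x -> -> _.
  by rewrite EFinD EFinM.
rewrite integralD//; last 2 first.
- by apply: integrableZl => //; exact: L1_integrable_on.
- exact: L1_integrable_on.
by rewrite integralZl//; exact: L1_integrable_on.
Qed.

Lemma integral_on_ae A f g : measurable A ->
  {ae mu, forall x, A x -> f x = g x} -> integral_on A f = integral_on A g.
Proof.
move=> mA fg; rewrite /integral_on; congr fine; apply: ae_eq_integral => //.
- exact: L1_measurable_on.
- exact: L1_measurable_on.
- by apply: filterS fg => x H Ax; rewrite H.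
Qed.

Lemma integral_on_ge0 A f : measurable A -> vle 0 f -> 0 <= integral_on A f.
Proof.
move=> mA /L1_vleP f0; rewrite -lee_fin integral_onE//.
(* [f] is nonnegative only almost everywhere, while [integral_ge0] wants it at every point. *)
have : (\int[mu]_(x in A) (Num.max (f x) 0)%:E = \int[mu]_(x in A) (f x)%:E)%E.
  apply: ae_eq_integral => //.
  - apply: measurable_funTS; apply/measurable_EFinP; apply: measurable_maxr => //.
    exact: L1_measurable.
  - exact: L1_measurable_on.
  - move: f0 (L1_0E mu); apply: filterS2 => x + e _; rewrite e => f0.
    by rewrite max_l.
move=> <-; apply: integral_ge0 => x _.
by rewrite lee_fin le_max lexx orbT.
Qed.

Lemma integral_onD A B f : measurable A -> measurable B -> B `<=` A ->
  integral_on A f = integral_on B f + integral_on (A `\` B) f.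
Proof.
move=> mA mB BA; have mAB : measurable (A `\` B) by exact: measurableD.
apply: EFin_inj; rewrite EFinD !integral_onE//.
rewrite -integral_setU//.
- by congr integral; rewrite setDUK.
- exact: L1_measurable_on.
- by rewrite disj_set2E; apply/eqP; rewrite setDE setICA setICr setI0.
Qed.

Lemma L1_vabsE f : {ae mu, forall x, vabs f x = `|f x|}.
Proof.
move: (L1_vsupE f (- f)) (L1_oppE f); apply: filterS2 => x -> ->.
by case: (ger0P (f x)) => r0; [rewrite max_l|rewrite max_r]; lra.
Qed.

Lemma L1_norm_integral f : `|f| = integral_on setT (vabs f).
Proof.
apply: EFin_inj; rewrite integral_onE// L1_normE; apply: ae_eq_integral => //.
- by apply: measurableT_comp => //; exact: L1_measurable_on.
- exact: L1_measurable_on.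
- by apply: filterS (L1_vabsE f) => x -> _.
Qed.

Lemma integrable_restr f A : measurable A ->
  mu.-integrable setT (fun x => (f x * \1_A x)%:E).
Proof.
move=> mA; apply: le_integrable (L1_integrable f) => //.
  apply/measurable_EFinP; apply: measurable_funM; first exact: L1_measurable.
  exact: measurable_indic.
move=> x _; rewrite lee_fin normrM indicE; case: (_ \in _);
  by rewrite ?normr1 ?normr0 ?mulr1 ?mulr0.
Qed.

Definition L1_restr A (mA : measurable A) f : L1 := toL1 (integrable_restr f mA).

Lemma L1_restrE A (mA : measurable A) f :
  {ae mu, forall x, L1_restr mA f x = f x * \1_A x}.
Proof. exact: toL1E. Qed.

Lemma L1_restr_on A (mA : measurable A) f B : measurable B -> B `<=` A ->
  integral_on B (vabs (L1_restr mA f - f)) = 0.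
Proof.
move=> mB BA; rewrite (@integral_on_ae B _ 0)//.
  have := integral_on_linear mB 1 0 0; rewrite scale1r addr0 mul1r => H; lra.
move: (L1_restrE mA f) (L1_vabsE (L1_restr mA f - f))
  (L1_subE (L1_restr mA f) f) (L1_0E mu).
apply: filterS4 => x e1 -> -> -> Bx; rewrite e1 indicE mem_set ?mulr1 ?subrr ?normr0//.
exact: BA.
Qed.

Lemma L1_restr_off A (mA : measurable A) f B : measurable B -> B `&` A = set0 ->
  integral_on B (vabs (L1_restr mA f)) = 0.
Proof.
move=> mB BA; rewrite (@integral_on_ae B _ 0)//.
  have := integral_on_linear mB 1 0 0; rewrite scale1r addr0 mul1r => H; lra.
move: (L1_restrE mA f) (L1_vabsE (L1_restr mA f)) (L1_0E mu).
apply: filterS3 => x e1 -> -> Bx; rewrite e1 indicE memNset ?mulr0 ?normr0//.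
by move=> Ax; have : (B `&` A) x by []; rewrite BA.
Qed.

(** The witness is [f] restricted to [B] plus [g] restricted to the rest of [A]. Agreement is
    phrased by vanishing integrals of moduli, which are the error terms of [approx_shift]. *)
Lemma L1_glue A B f g : measurable A -> measurable B -> B `<=` A -> exists h : L1,
  integral_on B (vabs (h - f)) = 0 /\ integral_on (A `\` B) (vabs (h - g)) = 0.
Proof.
move=> mA mB BA; have mAB : measurable (A `\` B) by exact: measurableD.
have iab (C : set T) (u v w : L1) : measurable C ->
  integral_on C (vabs (u - w)) = 0 -> integral_on C (vabs v) = 0 ->
  integral_on C (vabs (u + v - w)) = 0.
  move=> mC h1 h2; apply/le_anti/andP; split; last first.
    by apply: integral_on_ge0 => //; exact: vabs_ge0.
  have := integral_on_ge0 mC (_ : vle 0 (vabs (u - w) + vabs v - vabs (u + v - w))).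
  rewrite -vle_addr0 addrAC => /(_ (vabsD _ _)).
  have := integral_on_linear mC 1 (vabs (u - w)) (vabs v).
  have := integral_on_linear mC (-1) (vabs (u - w + v)) (vabs (u - w) + vabs v).
  by rewrite !scaleN1r scale1r [- _ + _]addrC h1 h2 => -> ->; lra.
exists (L1_restr mB f + L1_restr mAB g); split.
  apply: iab => //; first exact: L1_restr_on.
  by apply: L1_restr_off => //; rewrite setDE setICA setICr setI0.
rewrite [L1_restr mB f + _]addrC; apply: iab => //; first exact: L1_restr_on.
by apply: L1_restr_off => //; rewrite setDE -setIA [~` _ `&` _]setIC setICr setI0.
Qed.

End L1_integral.

Section linear_fun_theory.
Variables (R : realType) (V : lmodType R) (l : V -> R).
Hypothesis ll : linear_fun l.

Lemma linear_fun0 : l 0 = 0.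
Proof. by have := ll 1 0 0; rewrite scale1r addr0 => H; lra. Qed.

Lemma linear_funD x y : l (x + y) = l x + l y.
Proof. by have := ll 1 x y; rewrite scale1r mul1r. Qed.

Lemma linear_funZ a x : l (a *: x) = a * l x.
Proof. by have := ll a x 0; rewrite linear_fun0 !addr0. Qed.

Lemma linear_funN x : l (- x) = - l x.
Proof. by rewrite -scaleN1r linear_funZ mulN1r. Qed.

Lemma linear_funB x y : l (x - y) = l x - l y.
Proof. by rewrite linear_funD linear_funN. Qed.

End linear_fun_theory.

Definition positive_fun (R : realType) (V : banachLatticeType R) (l : V -> R) :=
  linear_fun l /\ forall x, vle 0 x -> 0 <= l x.

Section positive_fun_theory.
Variables (R : realType) (V : banachLatticeType R) (l : V -> R).
Hypothesis pl : positive_fun l.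

Lemma positive_fun_le x y : vle x y -> l x <= l y.
Proof.
by rewrite vle_addr0 => /pl.2; rewrite (linear_funB pl.1) subr_ge0.
Qed.

Lemma positive_fun_abs x : `|l x| <= l (vabs x).
Proof.
rewrite ler_norml positive_fun_le ?vle_abs// andbT.
by rewrite lerNl -(linear_funN pl.1) positive_fun_le ?vleN_abs.
Qed.

End positive_fun_theory.

Section L1_dual.
Import HBSimple.
Context d (T : measurableType d) (R : realType) (mu : {measure set T -> \bar R}).
Local Notation L1 := (LspaceType1 mu).
Hypothesis mu1 : mu setT = 1%E.

Lemma integral_on_positive A : measurable A -> positive_fun (@integral_on _ _ _ mu A).
Proof.
by move=> mA; split; [exact: integral_on_linear|move=> f; exact: integral_on_ge0].
Qed.

Lemma mu_fin_num A : measurable A -> mu A \is a fin_num.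
Proof.
move=> mA; rewrite ge0_fin_numE//; apply: (@le_lt_trans _ _ 1%E); last exact: ltry.
by rewrite -mu1; apply: le_measure; rewrite ?inE.
Qed.

Lemma integrable_ind A : measurable A ->
  mu.-integrable setT (EFin \o (\1_A : T -> R)).
Proof.
move=> mA; have [P PE] := unit_mass_probability mu1.
by rewrite -PE; apply: integrable_indic.
Qed.

Definition L1_ind A (mA : measurable A) : L1 := toL1 (integrable_ind mA).

Lemma L1_indE A (mA : measurable A) : {ae mu, forall x, L1_ind mA x = \1_A x}.
Proof. exact: toL1E. Qed.

Lemma integral_on_ind A (mA : measurable A) : integral_on setT (L1_ind mA) = fine (mu A).
Proof.
congr fine; transitivity (\int[mu]_x (\1_A x)%:E)%E.
  apply: ae_eq_integral => //.
  - exact: L1_measurable_on.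
  - exact/measurable_EFinP/measurable_indic.
  - by apply: filterS (L1_indE mA) => x -> _.
by rewrite integral_indic// setIT.
Qed.

(* Simple functions are dense in L1. *)
Lemma L1_ind_dense (D : L1 -> R) (M : R) : linear_fun D ->
  (forall f, `|D f| <= M * `|f|) ->
  (forall A (mA : measurable A), D (L1_ind mA) = 0) -> forall f, D f = 0.
Proof.
move=> lD DM D0 f.
have Dsum (r : seq R) (C : R -> set T) : (forall y, measurable (C y)) ->
  forall v : L1, {ae mu, forall x, v x = \sum_(y <- r) y * \1_(C y) x} -> D v = 0.
  move=> mC; elim: r => [|y r IH] v vE.
    suff -> : v = 0 by exact: linear_fun0.
    apply: L1P; move: vE (L1_0E mu); apply: filterS2 => x -> ->.
    by rewrite big_nil.
  rewrite -[v](subrK (y *: L1_ind (mC y))) linear_funD// linear_funZ// D0 mulr0 addr0.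
  apply: IH; move: vE (L1_subE v (y *: L1_ind (mC y))) (L1_scaleE y (L1_ind (mC y)))
    (L1_indE (mC y)); apply: filterS4 => x + -> -> ->.
  by rewrite big_cons => ->; rewrite addrAC subrr add0r.
have [g_ [ig_ _ cg]] := approximation_sfun_integrable measurableT (L1_integrable f).
have Dg n : D (toL1 (ig_ n)) = 0.
  apply: (Dsum (finmap.enum_fset (fset_set (g_ n @` setT)))
    (fun y => g_ n @^-1` [set y])).
    by move=> y; exact: measurable_funPTI.
  apply: filterS (toL1E (ig_ n)) => x ->.
  by rewrite fimfunE fsbig_finite.
have Df n : `|D f| <= M * `|f - toL1 (ig_ n)|.
  by rewrite -[D f]subr0 -(Dg n) -linear_funB.
have nE n : (`|f - toL1 (ig_ n)|%:E = \int[mu]_z `|(f z)%:E - (g_ n z)%:E|)%E.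
  rewrite L1_normE; apply: ae_eq_integral => //.
  - by apply: measurableT_comp => //; exact: L1_measurable_on.
  - apply: measurableT_comp => //; apply: emeasurable_funB.
      exact: L1_measurable_on.
    exact: measurable_int (ig_ n).
  - move: (toL1E (ig_ n)) (L1_subE f (toL1 (ig_ n))).
    by apply: filterS2 => x e1 -> _; rewrite e1 EFinB.
have c0 : (fun n => `|f - toL1 (ig_ n)|) @ \oo --> (0 : R).
  apply: (fine_cvg (f := fun n => `|f - toL1 (ig_ n)|%:E)).
  by rewrite (funext nE).
apply/eqP; rewrite -normr_le0.
have c1 : (fun n => M * `|f - toL1 (ig_ n)|) @ \oo --> (0 : R).
  by rewrite -[X in _ --> X](mulr0 M); apply: cvgM => //; exact: cvg_cst.
apply: (ler_cvg_to (cvg_cst `|D f|) c1).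
by apply: nearW => n; exact: Df.
Qed.

Variable l : L1 -> R.
Hypothesis pl : positive_fun l.
Hypothesis l_le : forall f, vle 0 f -> l f <= integral_on setT f.

(** The set function induced by [l] on indicators. [L1_ind] takes a proof of measurability, so
    nonmeasurable sets get the default value 0. *)
Let nu A : \bar R :=
  if pselect (measurable A) is left mA then (l (L1_ind mA))%:E else 0%E.

Let nuE A (mA : measurable A) : nu A = (l (L1_ind mA))%:E.
Proof.
rewrite /nu; case: pselect => // mA'; congr (_%:E); congr l.
by apply: L1P; move: (L1_indE mA) (L1_indE mA'); apply: filterS2 => x -> ->.
Qed.

Let ind_ge0 A (mA : measurable A) : vle 0 (L1_ind mA).
Proof.
apply/L1_vleP; move: (L1_indE mA) (L1_0E mu); apply: filterS2 => x -> ->.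
by rewrite indicE.
Qed.

Let nu0 : nu set0 = 0%E.
Proof.
rewrite (nuE measurable0); congr (_%:E).
rewrite (_ : L1_ind _ = 0) ?(linear_fun0 pl.1)//.
apply: L1P; move: (L1_indE (@measurable0 _ T)) (L1_0E mu); apply: filterS2 => x -> ->.
by rewrite indic0.
Qed.

Let nu_ge0 A : (0 <= nu A)%E.
Proof.
by rewrite /nu; case: pselect => // mA; rewrite lee_fin (pl.2 _ (ind_ge0 mA)).
Qed.

Let nuD A B : measurable A -> measurable B -> A `&` B = set0 ->
  nu (A `|` B) = (nu A + nu B)%E.
Proof.
move=> mA mB AB; rewrite (nuE mA) (nuE mB) (nuE (measurableU _ _ mA mB)) -EFinD.
rewrite -(linear_funD pl.1); congr (l _)%:E.
apply: L1P; move: (L1_indE mA) (L1_indE mB) (L1_indE (measurableU _ _ mA mB))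
   (L1_addE (L1_ind mA) (L1_ind mB)).
apply: filterS4 => x e1 e2 -> ->; rewrite e1 e2.
rewrite !indicE in_setU.
have [Ax|_] := boolP (x \in A); have [Bx|_] := boolP (x \in B) => /=.
- have : (A `&` B) x by split; exact: set_mem.
  by rewrite AB.
- by rewrite addr0.
- by rewrite add0r.
- by rewrite addr0.
Qed.

Let nu_le A : measurable A -> (nu A <= mu A)%E.
Proof.
move=> mA; rewrite (nuE mA) -[mu A]fineK ?mu_fin_num// lee_fin -(integral_on_ind mA).
exact: l_le (ind_ge0 mA).
Qed.

(** Finite additivity upgrades to countable additivity because the [nu]-mass of the tails is
    dominated by their [mu]-mass, which tends to 0. *)
Let nu_sigma_additive : semi_sigma_additive nu.
Proof.
move=> F mF tF mUF.
have mS n : measurable (\big[setU/set0]_(i < n) F i) by exact: bigsetU_measurable.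
have nuS n : (\sum_(0 <= i < n) nu (F i))%E = nu (\big[setU/set0]_(i < n) F i).
  elim: n => [|n IH]; first by rewrite big_ord0 big_geq.
  rewrite big_nat_recr//= IH big_ord_recr/= (nuD (mS n) (mF n))//.
  apply/seteqP; split=> // x []; rewrite -bigcup_mkord => -[i /= ni Fix] Fnx.
  have /trivIsetP/(_ i n I I) := tF; rewrite (ltn_eqF ni) => /(_ isT) E.
  by have : (F i `&` F n) x by []; rewrite E.
have muS n : (\sum_(0 <= i < n) mu (F i))%E = mu (\big[setU/set0]_(i < n) F i).
  by rewrite measure_bigsetU// big_mkord.
have rest n : measurable (\bigcup_k F k `\` \big[setU/set0]_(i < n) F i).
  exact: measurableD.
have sub n : \big[setU/set0]_(i < n) F i `<=` \bigcup_k F k.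
  by rewrite -bigcup_mkord; apply: bigcup_subset.
have nuR n : (nu (\bigcup_k F k) - \sum_(0 <= i < n) nu (F i) =
    nu (\bigcup_k F k `\` \big[setU/set0]_(i < n) F i))%E.
  rewrite nuS -{1}(setDUK (sub n)) (nuD (mS n) (rest n)); last first.
    by rewrite setDE setICA setICr setI0.
  by rewrite (nuE (mS n)) (nuE (rest n)) addeAC subee// add0e.
have muR n : (mu (\bigcup_k F k) - \sum_(0 <= i < n) mu (F i) =
    mu (\bigcup_k F k `\` \big[setU/set0]_(i < n) F i))%E.
  rewrite muS -{1}(setDUK (sub n)) measureU//; last by rewrite setDE setICA setICr setI0.
  by rewrite addeAC subee ?mu_fin_num// add0e.
have c1 : (fun n => mu (\bigcup_k F k) - \sum_(0 <= i < n) mu (F i))%E @ \oo --> 0%E.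
  have fU := mu_fin_num mUF; rewrite -[X in _ --> X](subee fU).
  apply: cvgeB; [by rewrite fin_num_adde_defr|exact: cvg_cst|].
  exact: measure_semi_sigma_additive.
have c2 : (fun n => nu (\bigcup_k F k) - \sum_(0 <= i < n) nu (F i))%E @ \oo --> 0%E.
  apply: (squeeze_cvge _ (cvg_cst 0%E) c1); apply: nearW => n.
  by rewrite nuR muR nu_ge0 nu_le.
have c3 : (fun n => nu (\bigcup_k F k) -
    (nu (\bigcup_k F k) - \sum_(0 <= i < n) nu (F i)))%E @ \oo --> nu (\bigcup_k F k).
  rewrite -[X in _ --> X]sube0; apply: cvgeB => //; last exact: cvg_cst.
  by rewrite (nuE mUF) fin_num_adde_defr.
suff <- : (fun n => nu (\bigcup_k F k) -
    (nu (\bigcup_k F k) - \sum_(0 <= i < n) nu (F i)))%E =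
    (fun n => \sum_(0 <= i < n) nu (F i))%E by [].
apply/funext => n; rewrite nuS (nuE mUF) (nuE (mS n)) -!EFinB; congr (_%:E); lra.
Qed.

HB.instance Definition _ := isMeasure.Build _ _ _ nu nu0 nu_ge0 nu_sigma_additive.

Let nu_fin : fin_num_fun nu.
Proof. by move=> A mA; rewrite (nuE mA). Qed.

HB.instance Definition _ := @Measure_isFinite.Build _ _ _ nu nu_fin.

Let density : exists h : T -> R, [/\ measurable_fun setT h, forall x, 0 <= h x,
  {ae mu, forall x, h x <= 1} &
  forall A (mA : measurable A), l (L1_ind mA) = fine (\int[mu]_(x in A) (h x)%:E)%E].
Proof.
have [P PE] := unit_mass_probability mu1.
have dom : nu `<< P.
  apply/null_content_dominatesP => A mA PA0; apply/eqP.
  by have := nu_le mA; rewrite eq_le nu_ge0 andbT -PE => /le_trans; apply; rewrite PA0.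
have [h [h0 hfin ihP hEP]] := radon_nikodym_sigma_finite dom.
have ih : mu.-integrable setT h by rewrite -PE; exact: ihP.
have hE A : measurable A -> nu A = (\int[mu]_(x in A) h x)%E.
  by move=> mA; rewrite -PE; exact: hEP.
have mh : measurable_fun setT h by exact: measurable_int ih.
have mh' : measurable_fun setT (fine \o h).
  by apply: (measurableT_comp (fine_measurable measurableT)).
have hK x : (fine (h x))%:E = h x by rewrite fineK.
exists (fine \o h); split=> //.
- by move=> x; rewrite fine_ge0.
(* The integral of [h - 1] over [N] is [nu N - mu N], hence at most 0, although [h - 1] is positive
   there; so [N] is null. *)
- pose N := [set x | (1 < h x)%E].
  have mN : measurable N.
    by rewrite -[N]setTI; apply: measurable_lte => //; exact: measurable_cst.
  have N0 : (\int[mu]_(x in N) `|h x - 1| = 0)%E.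
    apply/eqP; rewrite eq_le integral_ge0// andbT.
    rewrite (eq_integral (fun x => h x - cst 1 x)%E); last first.
      move=> x /set_mem Nx; rewrite gee0_abs// sube_ge0//; exact: ltW.
    rewrite integralB//.
    + rewrite -hE// integral_cst// mul1e sube_le0; exact: nu_le.
    + by apply: integrableS ih.
    + apply/integrableP; split; first exact: measurable_cst.
      under eq_integral do rewrite gee0_abs//.
      by rewrite integral_cst// mul1e ltey_eq mu_fin_num.
  have mhN : measurable_fun N (fun x => h x - 1)%E.
    by apply: emeasurable_funB; [exact: measurable_funTS|exact: measurable_cst].
  have := (ae_eq_integral_abs mu mN mhN).1 N0.
  apply: filterS => x H; rewrite -lee_fin hK leNgt; apply/negP => Nx.
  have := H Nx; move/eqP; rewrite sube_eq ?hfin// add0e => /eqP h1.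
  by rewrite h1 ltxx in Nx.
- move=> A mA; apply: EFin_inj; rewrite -nuE hE// fineK.
    by apply: eq_integral => x _; rewrite hK.
  rewrite (eq_integral h); last by move=> x _; rewrite /= hK.
  by apply: integrable_fin_num => //; exact: integrableS ih.
Qed.

Lemma L1_dual : exists2 g : T -> R,
  measurable_fun setT g /\ (forall x, 0 <= g x <= 1) &
  forall f, l f = fine (\int[mu]_x (f x * g x)%:E)%E.
Proof.
have [h [mh h0 h1 hE]] := density.
(* Truncation changes [h] on a null set only and makes the bound by 1 hold everywhere. *)
pose g x := Num.min (h x) 1.
have mg : measurable_fun setT g by apply: measurable_minr => //; exact: measurable_cst.
have g01 x : 0 <= g x <= 1 by rewrite /g le_min h0 ler01 ge_min lexx orbT.
exists g => // f.
have ig (u : L1) : mu.-integrable setT (fun x => (u x * g x)%:E).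
  apply: le_integrable (L1_integrable u) => //.
    by apply/measurable_EFinP; apply: measurable_funM => //; exact: L1_measurable.
  move=> x _; rewrite lee_fin normrM ler_piMr//.
  by have /andP[g0 g1] := g01 x; rewrite ger0_norm.
pose G u : L1 := toL1 (ig u).
have GE u : integral_on setT (G u) = fine (\int[mu]_x (u x * g x)%:E)%E.
  congr fine; apply: ae_eq_integral => //.
  - exact: L1_measurable_on.
  - exact: measurable_int (ig u).
  - by apply: filterS (toL1E (ig u)) => x -> _.
rewrite -GE; apply/eqP; rewrite -subr_eq0; apply/eqP.
have lint := integral_on_linear (mu := mu) measurableT.
have Gl (a : R) u v : G (a *: u + v) = a *: G u + G v.
  apply: L1P; have e1 := toL1E (ig (a *: u + v)); have e2 := toL1E (ig u).
  have e3 := toL1E (ig v); have e4 := L1_addE (a *: u) v; have e5 := L1_scaleE a u.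
  have e6 := L1_addE (a *: G u) (G v); have e7 := L1_scaleE a (G u).
  apply: filterS (filterI (filterI (filterI e1 e2) (filterI e3 e4))
    (filterI (filterI e5 e6) e7)).
  move=> x [[[E1 E2] [E3 E4]] [[E5 E6] E7]].
  by rewrite E6 E7 [G u x]E2 [G v x]E3 [LHS]E1 E4 E5 mulrDl mulrA.
(* [l] and integration against [g] are each bounded by the norm of [u], whence the constant 2. *)
apply: (@L1_ind_dense (fun u => l u - integral_on setT (G u)) 2).
- by move=> a u v; rewrite pl.1 Gl lint; lra.
- move=> u; apply: le_trans (ler_normB _ _) _.
  have h2 : `|l u| <= `|u|.
    apply: le_trans (positive_fun_abs pl _) _; rewrite L1_norm_integral.
    by apply: l_le; exact: vabs_ge0.
  suff : `|integral_on setT (G u)| <= `|u| by lra.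
  apply: le_trans (positive_fun_abs (integral_on_positive measurableT) _) _.
  rewrite -L1_norm_integral; apply: norm_vle_abs; apply/L1_vleP.
  move: (L1_vabsE (G u)) (L1_vabsE u) (toL1E (ig u)).
  apply: filterS3 => x -> -> ->; rewrite normrM ler_piMr//.
  by have /andP[g0 g1] := g01 x; rewrite ger0_norm.
- move=> A mA; rewrite hE GE; apply/eqP; rewrite subr_eq0; apply/eqP; congr fine.
  rewrite integral_mkcond; apply: ae_eq_integral => //.
  - by apply/(measurable_restrictT _ mA); apply/measurable_EFinP/measurable_funTS.
  - exact: measurable_int (ig _).
  - move: h1 (L1_indE mA); apply: filterS2 => x hx e _.
    rewrite patchE e indicE /g min_l//.
    by case: (x \in A); rewrite ?mul1r ?mul0r.
Qed.

End L1_dual.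

Section split_set.
Variables (R : realType) (I : Type) (mu : {measure set (cube R I) -> \bar R}).
Hypothesis mu_product : is_product_lebesgue mu.
Hypothesis I_uncountable : ~ countable [set: I].
Local Notation L1 := (LspaceType1 mu).

(** Being dominated by the integral over [A], [l] only sees the restrictions of the [f_ n] to [A].
    Applying [fresh_set] to these and to the density of [l] gives a set that is then cut down to
    [A]. *)
Lemma split_set (A : set (cube R I)) (l : L1 -> R) (f_ : nat -> L1) :
  measurable A -> positive_fun l ->
  (forall f, vle 0 f -> l f <= integral_on A f) ->
  exists B, [/\ measurable B, B `<=` A & forall n, integral_on B (f_ n) = l (f_ n)].
Proof.
move=> mA pl lA.
have mu1 := mu_setT mu_product.
have l_le f : vle 0 f -> l f <= integral_on setT f.
  move=> f0; apply: le_trans (lA _ f0) _.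
  rewrite (integral_onD f measurableT mA (@subsetT _ _)) lerDl.
  by apply: integral_on_ge0 => //; exact: measurableD.
have [g [mg g01] lg] := L1_dual mu1 pl l_le.
pose u n : L1 := L1_restr mA (f_ n).
have lu n : l (f_ n) = l (u n).
  apply/esym/eqP; rewrite -subr_eq0 -(linear_funB pl.1) -normr_le0.
  apply: le_trans (positive_fun_abs pl _) _; apply: le_trans (lA _ (vabs_ge0 _)) _.
  by rewrite (L1_restr_on mA).
have [B mB HB] := fresh_set mu_product I_uncountable (fun n => L1_integrable (u n)) mg g01.
have mBA : measurable (B `&` A) by exact: measurableI.
exists (B `&` A); split=> // n.
rewrite lu lg -HB -/(integral_on B (u n)).
rewrite (integral_onD (u n) mB mBA (@subIsetl _ _ _)).
have -> : integral_on (B `\` (B `&` A)) (u n) = 0.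
  have mD : measurable (B `\` (B `&` A)) by exact: measurableD.
  apply/eqP; rewrite -normr_le0.
  apply: le_trans (positive_fun_abs (integral_on_positive mu mD) _) _.
  rewrite L1_restr_off//; apply/seteqP; split=> // x [[Bx nBA] Ax].
  by apply: nBA.
rewrite addr0; apply: integral_on_ae => //.
move: (L1_restrE mA (f_ n)); apply: filterS => x -> [_ Ax].
by rewrite indicE mem_set// mulr1.
Qed.

End split_set.

(** * Band functionals *)

Section dense_sequences.
Variables (R : realType) (Y : banachLatticeType R).

Lemma separable_dense_seq : separable Y -> exists d_ : nat -> Y,
  forall y (e : R), 0 < e -> exists n, `|y - d_ n| < e.
Proof.
move=> [D cD dD].
have /countable_injP[f injf] := cD.
have /choice[d_ dE] (n : nat) : exists y, forall x, D x -> f x = n -> y = x.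
  have [[x [Dx fx]]|nx] := pselect (exists x, D x /\ f x = n).
    exists x => x' Dx' fx'; apply: injf; rewrite ?inE//.
    by rewrite fx fx'.
  by exists 0 => x Dx fx; case: nx; exists x.
exists d_ => y e e0.
have [z [/= yz Dz]] : (ball y e `&` D) !=set0.
  apply: dD; last exact: ball_open.
  by exists y; exact: ballxx.
by exists (f z); rewrite (dE _ z)//; move: yz; rewrite -ball_normE.
Qed.

(** For each point of a dense sequence of [Y] and each radius [1 / (m + 1)], a point of [X] within
    that radius is chosen when there is one, and 0 otherwise. *)
Lemma separable_dense_seq_sub (X : set Y) : separable Y -> X 0 ->
  exists2 x_ : nat -> Y, forall n, X (x_ n) &
  forall x (e : R), X x -> 0 < e -> exists n, `|x - x_ n| < e.
Proof.
move=> /separable_dense_seq[d_ dd] X0.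
have /choice[z_ zP] (km : nat * nat) : exists z, X z /\
    forall x, X x -> `|x - d_ km.1| < km.2.+1%:R^-1 -> `|z - d_ km.1| < km.2.+1%:R^-1.
  have [[z [Xz zd]]|nz] :=
    pselect (exists z, X z /\ `|z - d_ km.1| < km.2.+1%:R^-1); first by exists z.
  by exists 0; split=> // x Xx xd; case: nz; exists x.
exists (fun n => if unpickle n is Some km then z_ km else 0).
  by move=> n; case: unpickle => // km; exact: (zP km).1.
move=> x e Xx e0; have e20 : 0 < e / 2 by rewrite divr_gt0.
have [m me] : exists m, m.+1%:R^-1 < e / 2.
  by have /filter_ex[m /= me] := near_infty_natSinv_lt (PosNum e20); exists m.
have m0 : 0 < m.+1%:R^-1 :> R by rewrite invr_gt0.
have [k kx] := dd x _ m0.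
exists (pickle (k, m)); rewrite pickleK.
have := (zP (k, m)).2 x Xx kx => /= zk.
rewrite -(subrK (d_ k) x) -addrA (le_lt_trans (ler_normD _ _))//.
by rewrite [ltRHS]splitr ltrD// ?(lt_trans kx)// distrC (lt_trans zk).
Qed.

End dense_sequences.

Section lattice_hom_theory.
Variables (R : realType) (Y Z : banachLatticeType R) (X : set Y) (T : Y -> Z).
Hypothesis sX : sublattice X.
Hypothesis hT : lattice_hom X T.

Lemma sublattice0 : X 0. Proof. by have [] := sX. Qed.

Lemma sublatticeZ a x : X x -> X (a *: x).
Proof.
by move=> Xx; have [X0 XD _ _] := sX; rewrite -[a *: x]addr0; exact: XD.
Qed.

Lemma sublatticeD x y : X x -> X y -> X (x + y).
Proof.
by move=> Xx Xy; have [X0 XD _ _] := sX; rewrite -[x]scale1r; exact: XD.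
Qed.

Lemma sublatticeN x : X x -> X (- x).
Proof. by move=> Xx; rewrite -scaleN1r; exact: sublatticeZ. Qed.

Lemma sublatticeB x y : X x -> X y -> X (x - y).
Proof. by move=> Xx Xy; apply: sublatticeD => //; exact: sublatticeN. Qed.

Lemma sublattice_abs x : X x -> X (vabs x).
Proof. by move=> Xx; have [_ _ XU _] := sX; apply: XU => //; exact: sublatticeN. Qed.

Lemma sublattice_pos x : X x -> X (vpos x).
Proof. by move=> Xx; have [X0 _ XU _] := sX; exact: XU. Qed.

Lemma lattice_homZD a x y : X x -> X y -> T (a *: x + y) = a *: T x + T y.
Proof. by have [H _ _ _] := hT; exact: H. Qed.

Lemma lattice_hom0 : T 0 = 0.
Proof.
have := lattice_homZD 1 sublattice0 sublattice0.
by rewrite !scale1r addr0 => /eqP; rewrite eq_sym -subr_eq0 addrK => /eqP.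
Qed.

Lemma lattice_homZ a x : X x -> T (a *: x) = a *: T x.
Proof.
by move=> Xx; have := lattice_homZD a Xx sublattice0; rewrite lattice_hom0 !addr0.
Qed.

Lemma lattice_homN x : X x -> T (- x) = - T x.
Proof. by move=> Xx; rewrite -scaleN1r lattice_homZ// scaleN1r. Qed.

Lemma lattice_homB x y : X x -> X y -> T (x - y) = T x - T y.
Proof.
move=> Xx Xy; rewrite -[x]scale1r lattice_homZD ?lattice_homN ?scale1r//.
exact: sublatticeN.
Qed.

Lemma lattice_hom_abs x : X x -> T (vabs x) = vabs (T x).
Proof.
move=> Xx; have [_ TU _ _] := hT; rewrite TU ?lattice_homN//.
exact: sublatticeN.
Qed.

Lemma lattice_hom_pos x : X x -> T (vpos x) = vpos (T x).
Proof.
by move=> Xx; have [_ TU _ _] := hT; rewrite TU ?lattice_hom0//; exact: sublattice0.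
Qed.

End lattice_hom_theory.

Section positive_fun_more.
Variables (R : realType) (V : banachLatticeType R).
Implicit Types (l p : V -> R).

Lemma positive_fun_dist l x y : positive_fun l ->
  `|l (vabs x) - l (vabs y)| <= l (vabs (x - y)).
Proof.
move=> pl; have H u v : l (vabs u) <= l (vabs (u - v)) + l (vabs v).
  rewrite -(linear_funD pl.1); apply: positive_fun_le => //.
  by rewrite -{1}(subrK v u); exact: vabsD.
have := H y x; have := H x y; rewrite (vabs_distC y) => h1 h2.
by rewrite ler_norml; apply/andP; split; lra.
Qed.

Lemma positive_fun_sublinear l : positive_fun l -> sublinear (fun x => l (vpos x)).
Proof.
move=> pl; split=> [x y|a x a0]; last by rewrite vposZ// (linear_funZ pl.1).
by rewrite -(linear_funD pl.1); apply: positive_fun_le => //; exact: vposD_le.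
Qed.

Lemma positive_fun_below l (p : V -> R) : linear_fun l -> (forall x, l x <= p x) ->
  (forall x, vle 0 x -> p (- x) <= 0) -> positive_fun l.
Proof.
move=> ll lp p0; split=> // x x0.
by have := lp (- x); have := p0 _ x0; rewrite (linear_funN ll) => h1 h2; lra.
Qed.

Lemma vposN0 (x : V) : vle 0 x -> vpos (- x) = 0.
Proof.
move=> x0; apply: vle_antiP; last exact: vpos_ge0.
by apply: vsup_lub; [rewrite -[X in vle _ X]oppr0; exact: (vleN x0)|exact: vlexx].
Qed.

Lemma vabs_le_pos (x : V) : vle (vabs x) (vpos x + vpos (- x)).
Proof.
apply: vabs_lub.
  rewrite -[X in vle X _]addr0; apply: vleD; [exact: vle_vpos|exact: vpos_ge0].
rewrite -[X in vle X _]add0r; apply: vleD; [exact: vpos_ge0|exact: vle_vpos].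
Qed.

End positive_fun_more.

Section band_functional.
Variables (R : realType) (Y : banachLatticeType R) (X : set Y) (b : Y -> R) (C : R).
Hypothesis sX : sublattice X.
Hypothesis C0 : 0 <= C.
Hypothesis bD : forall a x y, X x -> X y -> b (a *: x + y) = a * b x + b y.
Hypothesis b_pos : forall x, X x -> b x <= b (vpos x).
Hypothesis b_le : forall x, X x -> b x <= C * `|x|.

(** [mazur_orlicz] only gives [b <= l] on [X]; since [X] is a subspace, applying this to [- x]
    yields equality. The last hypothesis on [p] makes [l] positive. *)
Lemma extend_functional (p : Y -> R) : sublinear p ->
  (forall x, X x -> b x <= p x) -> (forall y, vle 0 y -> p (- y) <= 0) ->
  exists2 l : Y -> R, positive_fun l &
    (forall y, l y <= p y) /\ forall x, X x -> l x = b x.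
Proof.
move=> sp bp p0.
have [l [ll lp bl]] := mazur_orlicz (f := id) (sublattice0 sX) (fun a s t _ Xs Xt =>
  And3 (let: And4 _ H _ _ := sX in H a s t Xs Xt) erefl (bD a Xs Xt)) sp bp.
exists l; first exact: positive_fun_below p0.
split=> // x Xx; apply/le_anti; rewrite bl// andbT.
have := bl _ (sublatticeN sX Xx); rewrite (linear_funN ll).
have := bD (-1) Xx (sublattice0 sX); rewrite scaleN1r addr0 => ->.
have := bD 1 (sublattice0 sX) (sublattice0 sX); rewrite scale1r addr0 => h1 h2; lra.
Qed.

Variable x_ : nat -> Y.
Hypothesis Xx_ : forall n, X (x_ n).
Hypothesis x_dense : forall x (e : R), X x -> 0 < e -> exists n, `|x - x_ n| < e.

Let S n := \sum_(i < n) vabs (x_ i).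

(* This increasing sequence generates the same band as [X]. *)
Definition majorants n : Y := n%:R *: S n.
Local Notation E := majorants.

Let S_ge0 n : vle 0 (S n).
Proof. by apply: (vsum_ge0 (f := fun i => vabs (x_ i))) => i; exact: vabs_ge0. Qed.

Let S_le n m : (n <= m)%N -> vle (S n) (S m).
Proof.
move=> nm; rewrite -(subnKC nm) /S big_split_ord/=.
rewrite -[X in vle X _]addr0; apply: vleD; first exact: vlexx.
by apply: (vsum_ge0 (f := fun i => vabs (x_ (n + i)))) => i; exact: vabs_ge0.
Qed.

Lemma majorants_ge0 n : vle 0 (E n).
Proof. by apply: vscaler_ge0 => //; exact: S_ge0. Qed.

Lemma majorants_sub n : X (E n).
Proof.
apply: sublatticeZ => //; rewrite /S; elim/big_ind: _ => //.
- exact: sublattice0.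
- by move=> x y; exact: sublatticeD.
- by move=> i _; exact: sublattice_abs.
Qed.

(** Multiples are absorbed because both the factor and the number of summands of [E] grow with the
    index; homogeneity of the band part [p] below rests on this. *)
Let E_scale (c : R) n : exists m, vle (c *: E n) (E m) /\ (n <= m)%N.
Proof.
have [k ck] : exists k, c <= k%:R.
  exists (Num.bound `|c|); apply: le_trans (ler_norm c) _; apply: ltW; exact: archi_boundP.
exists (k.+1 * n)%N; split; last by rewrite leq_pmull.
apply: (vle_le_trans (vleZr (majorants_ge0 n) ck)).
rewrite /majorants scalerA -natrM; apply: (@vle_le_trans _ _ _ ((k.+1 * n)%:R *: S n)).
  by apply: vleZr (S_ge0 n) _; rewrite ler_nat leq_mul2r leqnSn orbT.
by apply: vleZ => //; apply: S_le; rewrite leq_pmull.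
Qed.

Let E_le n m : (n <= m)%N -> vle (E n) (E m).
Proof.
move=> nm; apply: (@vle_le_trans _ _ _ (m%:R *: S n)).
  by apply: vleZr (S_ge0 n) _; rewrite ler_nat.
by apply: vleZ => //; exact: S_le.
Qed.

Let E_add n k : exists m, vle (E n + E k) (E m).
Proof.
have [m [Em _]] := E_scale 2 (maxn n k); exists m; apply: vle_le_trans _ Em.
rewrite -[2]/(1 + 1)%:R scaler_nat mulr2n.
by apply: vleD; apply: E_le; rewrite ?leq_maxl ?leq_maxr.
Qed.

(** A first extension [l0] has the right norm bound but may charge elements disjoint from [X].
    Passing to its band part [p] and extending once more below [p] gives a functional for which the
    [E m] exhaust every positive element. *)
Lemma band_functional : exists2 l : Y -> R, positive_fun l &
  [/\ forall x, X x -> l x = b x, forall y, vle 0 y -> l y <= C * `|y|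
    & forall y (e : R), vle 0 y -> 0 < e -> exists m, l (vpos (y - E m)) < e].
Proof.
have [|x Xx|y y0|l0 pl0 [l0p l0b]] := @extend_functional (fun y => C * `|vpos y|).
- split=> [x y|a x a0]; last by rewrite vposZ// normrZ ger0_norm// mulrCA.
  rewrite -mulrDr ler_wpM2l//; apply: le_trans (ler_normD _ _).
  by apply: norm_vle; [exact: vpos_ge0|exact: vposD_le].
- by apply: le_trans (b_pos Xx) _; apply: b_le; exact: sublattice_pos.
- by rewrite vposN0// normr0 mulr0.
have l0_le y : vle 0 y -> l0 y <= C * `|y| by move=> y0; rewrite -{2}(vpos_id y0).
pose p y := sup [set l0 (vinf (E n) (vpos y)) | n in [set: nat]].
have p_ge y n : l0 (vinf (E n) (vpos y)) <= p y.
  apply: ub_le_sup; last by exists n.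
  exists (l0 (vpos y)) => _ [m _ <-]; apply: positive_fun_le => //; exact: vinfr.
have p_le y c : (forall n, l0 (vinf (E n) (vpos y)) <= c) -> p y <= c.
  move=> H; apply: ge_sup; first by exists (l0 (vinf (E 0%N) (vpos y))), 0%N.
  by move=> _ [n _ <-].
have ppos y : vle 0 y -> p y <= l0 y.
  move=> y0; apply: p_le => n; apply: positive_fun_le => //.
  by rewrite vpos_id//; exact: vinfr.
have vinf0 n : vinf (E n) 0 = 0.
  by rewrite vinfC; apply: vinf_idPl; exact: majorants_ge0.
have sp : sublinear p.
  apply: sublinear_pos => [x y||a x a0].
  - apply: p_le => n.
    apply: (@le_trans _ _ (l0 (vinf (E n) (vpos x) + vinf (E n) (vpos y)))).
      apply: positive_fun_le => //.
      apply: (@vle_le_trans _ _ _ (vinf (E n) (vpos x + vpos y))).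
        by apply: vinf_leS; [exact: vlexx|exact: vposD_le].
      by apply: vinfD_le; [exact: majorants_ge0|exact: vpos_ge0|exact: vpos_ge0].
    by rewrite (linear_funD pl0.1) lerD.
  - apply/le_anti/andP; split.
      apply: p_le => n; rewrite vpos_id; last exact: vlexx.
      by rewrite vinf0 (linear_fun0 pl0.1).
    apply: le_trans (p_ge 0 0%N); rewrite vpos_id; last exact: vlexx.
    by rewrite vinf0 (linear_fun0 pl0.1).
  - apply: p_le => n; have [m [Em _]] := E_scale a^-1 n.
    apply: (@le_trans _ _ (l0 (a *: vinf (E m) (vpos x)))); last first.
      by rewrite (linear_funZ pl0.1) ler_wpM2l// ltW.
    apply: positive_fun_le => //; rewrite vposZ ?ltW//.
    rewrite -[X in vle X _](scalerKV (lt0r_neq0 a0)); apply: vleZ; first exact: ltW.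
    have a'0 : 0 <= a^-1 by rewrite invr_ge0 ltW.
    apply: vinf_glb; first exact: vle_le_trans (vleZ a'0 (vinfl _ _)) Em.
    rewrite -[X in vle _ X](scalerK (lt0r_neq0 a0)); apply: vleZ => //; exact: vinfr.
have pX x : X x -> b x <= p x.
  move=> Xx; rewrite -l0b//; apply: le_trans (positive_fun_le pl0 (vle_vpos x)) _.
  apply/ler_addgt0Pr => e e0.
  have Xv := sublattice_pos sX Xx.
  have [i xi] : exists i, C * `|vpos x - x_ i| < e.
    have d0 : 0 < e / (C + 1) by rewrite divr_gt0// ltr_wpDl.
    have [i xi] := x_dense Xv d0.
    exists i; apply: (@le_lt_trans _ _ ((C + 1) * `|vpos x - x_ i|)).
      by rewrite ler_wpM2r// lerDl.
    by rewrite mulrC -ltr_pdivlMr// ltr_wpDl.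
  (* The index [i.+1] puts [x_ i] among the summands of [S] and makes the factor at least 1. *)
  rewrite -lerBlDl; apply: le_trans (_ : l0 (vpos x) - l0 (vinf (E i.+1) (vpos x)) <= _).
    by rewrite lerD2l lerN2.
  rewrite vinfC -(linear_funB pl0.1) -vposE; apply: ltW; apply: le_lt_trans xi.
  apply: le_trans (l0_le _ (vpos_ge0 _)) _; rewrite ler_wpM2l//.
  apply: le_trans (norm_vpos _); apply: norm_vle; first exact: vpos_ge0.
  apply: vposS; apply: vleB; first exact: vlexx.
  apply: (vle_le_trans (vle_abs _)); rewrite -[X in vle X _]scale1r.
  apply: (@vle_le_trans _ _ _ (i.+1%:R *: vabs (x_ i))).
    by apply: vleZr; [exact: vabs_ge0|rewrite ler1n].
  apply: vleZ => //; rewrite /S big_ord_recr/= -[X in vle X _]add0r.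
  by apply: vleD; [exact: S_ge0|exact: vlexx].
have [y y0|l pl [lp lb]] := extend_functional sp pX.
  apply: p_le => n; rewrite vposN0//.
  by rewrite vinf0 (linear_fun0 pl0.1).
exists l => //; split=> //.
  by move=> y y0; apply: le_trans (lp y) _; apply: le_trans (ppos y y0) (l0_le y y0).
move=> y e y0 e0.
(* If [E m] nearly attains the supremum defining [p y], little is left for the excess of [y] over
   [E m]: a truncation of the excess and one of [y] add up to at most a single truncation of [y]. *)
have [m pm] : exists m, p y - e / 2 < l0 (vinf (E m) y).
  apply: contrapT => /forallNP H.
  have : p y <= p y - e / 2.
    by apply: p_le => n; rewrite vpos_id// leNgt; apply/negP/H.
  by rewrite leNgt ltrBlDr ltrDl divr_gt0.
exists m; apply: le_lt_trans (lp _) _; apply: (@le_lt_trans _ _ (e / 2)); last lra.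
apply: p_le => n; rewrite vpos_id; last exact: vpos_ge0.
have [k Ek] := E_add n m.
suff : l0 (vinf (E n) (vpos (y - E m))) + l0 (vinf (E m) y) <= p y by lra.
apply: le_trans (p_ge _ k); rewrite -(linear_funD pl0.1); apply: positive_fun_le => //.
rewrite (vpos_id y0) vposE; apply: vinf_glb.
  apply: vle_le_trans _ Ek; apply: vleD; exact: vinfl.
rewrite -[X in vle _ X](subrK (vinf y (E m)) y); apply: vleD; first exact: vinfr.
by rewrite vinfC; exact: vlexx.
Qed.

End band_functional.

(** * The tree of functionals and sets *)

Section leaves.
Variables (R : realType) (I : Type) (mu : {measure set (cube R I) -> \bar R}).
Hypothesis mu_product : is_product_lebesgue mu.
Hypothesis I_uncountable : ~ countable [set: I].
Local Notation L1 := (LspaceType1 mu).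
Variables (Y : banachLatticeType R) (X : set Y) (T : Y -> L1) (C : R).
Hypothesis sX : sublattice X.
Hypothesis hT : lattice_hom X T.
Hypothesis C_ge0 : 0 <= C.
Hypothesis TC : forall x, X x -> `|T x| <= C * `|x|.

(* [leaf_fun] is to be [fun y => integral_on leaf_set (T' y)] for the extension
   [T'] of [T] under construction. *)
Record leaf := Leaf {
  leaf_fun : Y -> R;
  leaf_set : set (cube R I);
  leaf_positive : positive_fun leaf_fun;
  leaf_measurable : measurable leaf_set;
  leaf_compat : forall x, X x -> leaf_fun x = integral_on leaf_set (T x) }.

Lemma integral_on_le A (f : L1) : measurable A -> vle 0 f -> integral_on A f <= `|f|.
Proof.
move=> mA f0; rewrite L1_norm_integral vabs_id//.
rewrite (integral_onD f measurableT mA (@subsetT _ _)) lerDl.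
by apply: integral_on_ge0 => //; exact: measurableD.
Qed.

Lemma leaf_fun_le (l : leaf) x : X x -> leaf_fun l (vabs x) <= C * `|x|.
Proof.
move=> Xx; have Xa := sublattice_abs sX Xx; rewrite leaf_compat//.
apply: (@le_trans _ _ `|T (vabs x)|).
  apply: integral_on_le; first exact: leaf_measurable.
  by rewrite (lattice_hom_abs sX hT)//; exact: vabs_ge0.
by rewrite -[`|x|]norm_vabs; exact: TC.
Qed.

Variable x_ : nat -> Y.
Hypothesis Xx_ : forall n, X (x_ n).
Hypothesis x_dense : forall x (e : R), X x -> 0 < e -> exists n, `|x - x_ n| < e.

(* The part of the functional of [l] on which [u >= 0] is first transported to
   a functional on [L1] dominated by the integral over the set of [l], which is
   then realized by a subset. *)
Lemma leaf_split (l : leaf) (u : Y) : exists l1 l0 : leaf,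
  [/\ forall y, leaf_fun l y = leaf_fun l0 y + leaf_fun l1 y,
      leaf_set l1 `<=` leaf_set l /\ leaf_set l0 = leaf_set l `\` leaf_set l1,
      leaf_fun l1 (vpos (- u)) = 0 & leaf_fun l0 (vpos u) = 0].
Proof.
have mA := leaf_measurable l; have pf := leaf_positive l.
have sf := positive_fun_sublinear pf.
have f0 (y : Y) : vle 0 y -> leaf_fun l (vpos (- y)) <= 0.
  by move=> y0; rewrite vposN0// (linear_fun0 pf.1).
(* Forcing [f1 u] up to [leaf_fun l (vpos u)] makes [f1] keep the whole mass of the positive part of
   [u] and none of its negative part. *)
have [|a s t a0 s0 t0|t t0|f1 [lf1 f1p f1u]] := @mazur_orlicz R Y R^o [set t | 0 <= t]
    (fun t => t *: u) (fun t => t * leaf_fun l (vpos u)) _ _ _ sf.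
- exact: lexx.
- split => /=; first by rewrite addr_ge0// mulr_ge0.
    by rewrite scalerDl scalerA.
  by rewrite mulrDl mulrA.
- by rewrite vposZ// (linear_funZ pf.1).
have pf1 : positive_fun f1 := positive_fun_below lf1 f1p f0.
have f1_le y : vle 0 y -> f1 y <= leaf_fun l y.
  by move=> y0; rewrite -{2}(vpos_id y0); exact: f1p.
have {}f1u : f1 u = leaf_fun l (vpos u).
  apply/le_anti; rewrite f1p/=.
  by have := f1u 1 ler01; rewrite scale1r mul1r.
have pI := @integral_on_positive _ _ _ mu _ mA.
(* The bound [f1 x <= leaf_fun l (vpos x)] is a bound in terms of [T x] alone, since [T] commutes
   with positive parts and the leaf is compatible with [T]. *)
have [||||k [lk kp kb]] := mazur_orlicz (V := L1) (W := Y) (C := X) (f := T) (b := f1)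
    (p := fun f => integral_on (leaf_set l) (vpos f)).
- exact: sublattice0.
- move=> a s t _ Xs Xt; split; last exact: lf1.
    by have [_ H _ _] := sX; exact: H.
  exact: lattice_homZD Xs Xt.
- exact: positive_fun_sublinear.
- move=> x Xx; rewrite -(lattice_hom_pos sX hT)// -leaf_compat; last exact: sublattice_pos.
  exact: f1p.
have pk : positive_fun k.
  apply: positive_fun_below lk kp _ => f f0'.
  by rewrite vposN0// (linear_fun0 pI.1).
have k_le f : vle 0 f -> k f <= integral_on (leaf_set l) f.
  by move=> f0'; rewrite -{2}(vpos_id f0'); exact: kp.
have kT x : X x -> k (T x) = f1 x.
  move=> Xx; apply/le_anti; rewrite kb// andbT.
  have := kb _ (sublatticeN sX Xx); rewrite (linear_funN lf1).
  by rewrite (lattice_homN sX hT)// (linear_funN lk) lerN2.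
have [B [mB BA HB]] := split_set mu_product I_uncountable (fun n => T (x_ n)) mA pk k_le.
have pB := @integral_on_positive _ _ _ mu _ mB.
(* [split_set] handles only the [x_ n]; both sides are Lipschitz with constant [C], so density gives
   all of [X]. *)
have BX x : X x -> f1 x = integral_on B (T x).
  move=> Xx; apply/eqP; rewrite -subr_eq0 -normr_le0; apply/ler_addgt0Pr => e e0.
  have [i xi] : exists i, C * `|x - x_ i| < e / 2.
    have d0 : 0 < e / 2 / (C + 1) by rewrite !divr_gt0// ltr_wpDl.
    have [i xi] := x_dense Xx d0.
    exists i; apply: (@le_lt_trans _ _ ((C + 1) * `|x - x_ i|)).
      by rewrite ler_wpM2r// lerDl.
    by rewrite mulrC -ltr_pdivlMr// ltr_wpDl.
  have Xd : X (x - x_ i) by exact: sublatticeB.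
  have Xa : X (vabs (x - x_ i)) by exact: sublattice_abs.
  have -> : f1 x - integral_on B (T x) = f1 (x - x_ i) - integral_on B (T (x - x_ i)).
    rewrite (linear_funB lf1) (lattice_homB sX hT)// (linear_funB pB.1) HB kT//; lra.
  have h1 : `|f1 (x - x_ i)| <= C * `|x - x_ i|.
    apply: le_trans (positive_fun_abs pf1 _) _.
    by apply: le_trans (f1_le _ (vabs_ge0 _)) _; exact: leaf_fun_le.
  have h2 : `|integral_on B (T (x - x_ i))| <= C * `|x - x_ i|.
    apply: le_trans (positive_fun_abs pB _) _.
    apply: le_trans (integral_on_le mB (vabs_ge0 _)) _.
    by rewrite norm_vabs; exact: TC.
  by apply: le_trans (ler_normB _ _) _; lra.
pose f2 y := leaf_fun l y - f1 y.
have pf2 : positive_fun f2.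
  split=> [a y z|y y0]; last by rewrite subr_ge0 f1_le.
  by rewrite /f2 pf.1 lf1; lra.
have mAB : measurable (leaf_set l `\` B) by exact: measurableD.
have f2X x : X x -> f2 x = integral_on (leaf_set l `\` B) (T x).
  move=> Xx; rewrite /f2 leaf_compat// BX//.
  by rewrite (integral_onD (T x) mA mB BA); lra.
exists (Leaf pf1 mB BX), (Leaf pf2 mAB f2X); split=> //=.
- by move=> y; rewrite /f2 subrK.
- have h1 := f1_le _ (vpos_ge0 u); have h2 := pf1.2 _ (vpos_ge0 (- u)).
  have := linear_funB lf1 (vpos u) (vpos (- u)); rewrite -vposB f1u => h3.
  by apply/le_anti/andP; split; lra.
- have h1 := f1_le _ (vpos_ge0 u); have h2 := pf1.2 _ (vpos_ge0 (- u)).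
  have := linear_funB lf1 (vpos u) (vpos (- u)); rewrite -vposB f1u => h3.
  by rewrite /f2; apply/le_anti/andP; split; lra.
Qed.

End leaves.

Section tree.
Variables (R : realType) (I : Type) (mu : {measure set (cube R I) -> \bar R}).
Local Notation L1 := (LspaceType1 mu).
Variables (Y : banachLatticeType R) (X : set Y) (T : Y -> L1).
Hypothesis sX : sublattice X.
Hypothesis hT : lattice_hom X T.
Local Notation leaf := (leaf X T).
Variables (right left : leaf -> Y -> leaf).
Hypothesis splitP : forall l u,
  [/\ forall y, leaf_fun l y = leaf_fun (left l u) y + leaf_fun (right l u) y,
      leaf_set (right l u) `<=` leaf_set l /\
      leaf_set (left l u) = leaf_set l `\` leaf_set (right l u),
      leaf_fun (right l u) (vpos (- u)) = 0 & leaf_fun (left l u) (vpos u) = 0].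
Variable u_ : nat -> Y.

Local Notation on l := (@integral_on _ _ _ mu (leaf_set l)).

Let leaf_funD l u y : leaf_fun l y = leaf_fun (left l u) y + leaf_fun (right l u) y.
Proof. by have [] := splitP l u. Qed.

Let onD l u f : on l f = on (left l u) f + on (right l u) f.
Proof.
have [_ [s1 s0] _ _] := splitP l u; rewrite s0 addrC.
by apply: integral_onD => //; exact: leaf_measurable.
Qed.

Let pon (l : leaf) : positive_fun (on l : L1 -> R).
Proof. exact: integral_on_positive (leaf_measurable l). Qed.

Let pfun (l : leaf) : positive_fun (leaf_fun l) := leaf_positive l.

Definition leaf_dist (l : leaf) (y : Y) (F : L1) (x : Y) : R :=
  leaf_fun l (vabs (y - x)) + on l (vabs (F - T x)).

(* [tree_approx n l y F e]: some finite subtree below the node [l] of depth [n],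
   with leaves labelled by elements [x] of [X], has total [leaf_dist] to the
   pair [(y, F)] at most [e]. *)
Inductive tree_approx : nat -> leaf -> Y -> L1 -> R -> Prop :=
| approx_leaf n l y F e x : X x -> leaf_dist l y F x <= e -> tree_approx n l y F e
| approx_node n l y F e1 e0 : tree_approx n.+1 (right l (u_ n)) y F e1 ->
    tree_approx n.+1 (left l (u_ n)) y F e0 -> tree_approx n l y F (e1 + e0).

Lemma approx_le n l y F e e' : tree_approx n l y F e -> e <= e' -> tree_approx n l y F e'.
Proof.
move=> H; elim: H e' => {n l y F e}
    [n l y F e x Xx xe e' ee'|n l y F e1 e0 _ IH1 _ IH0 e' ee'].
  by apply: approx_leaf Xx (le_trans xe ee').
rewrite -(subrK e0 e'); apply: approx_node; first by apply: IH1; lra.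
by apply: IH0.
Qed.

Lemma leaf_distD l u y F x :
  leaf_dist l y F x = leaf_dist (right l u) y F x + leaf_dist (left l u) y F x.
Proof. by rewrite /leaf_dist (leaf_funD l u) (onD l u); lra. Qed.

(** A leaf can be replaced by a node whose two children carry the same label, so any two trees admit
    a common refinement. *)
Lemma approx_down n l y F e : tree_approx n l y F e -> exists e1 e0,
  [/\ e = e1 + e0, tree_approx n.+1 (right l (u_ n)) y F e1
    & tree_approx n.+1 (left l (u_ n)) y F e0].
Proof.
case=> {n l y F e} [n l y F e x Xx|n l y F e1 e0 H1 H0]; last by exists e1, e0.
rewrite (leaf_distD l (u_ n)) => xe.
exists (leaf_dist (right l (u_ n)) y F x), (e - leaf_dist (right l (u_ n)) y F x).
split; first by lra.
- exact: approx_leaf Xx (lexx _).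
- by apply: approx_leaf Xx _; lra.
Qed.

Section approx2.
Variables (G : Y -> Y -> Y) (H : L1 -> L1 -> L1) (a : R).
Hypothesis XG : forall x x', X x -> X x' -> X (G x x').
Hypothesis TG : forall x x', X x -> X x' -> T (G x x') = H (T x) (T x').
Hypothesis G_lip : forall x x' y y',
  vle (vabs (G x x' - G y y')) (a *: vabs (x - y) + vabs (x' - y')).
Hypothesis H_lip : forall x x' y y',
  vle (vabs (H x x' - H y y')) (a *: vabs (x - y) + vabs (x' - y')).

Let leaf_dist2 l y F x y' F' x' : X x -> X x' ->
  leaf_dist l (G y y') (H F F') (G x x') <= a * leaf_dist l y F x + leaf_dist l y' F' x'.
Proof.
move=> Xx Xx'; rewrite /leaf_dist TG//.
have := positive_fun_le (pfun l) (G_lip y y' x x').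
have := positive_fun_le (pon l) (H_lip F F' (T x) (T x')).
by rewrite (pfun l).1 (pon l).1; lra.
Qed.

(** The two trees are refined against each other: where one stops earlier, its label is copied to
    both children. [G] and [H] are abstract so that linear combinations and suprema are treated at
    once, [a] being the Lipschitz constant in the first argument. *)
Lemma approx2 n l y F e y' F' e' : 0 <= a ->
  tree_approx n l y F e -> tree_approx n l y' F' e' ->
  tree_approx n l (G y y') (H F F') (a * e + e').
Proof.
move=> a0 A; elim: A y' F' e' => {n l y F e}
    [n l y F e x Xx xe y' F' e' A'|n l y F e1 e0 A1 IH1 A0 IH0 y' F' e'].
  elim: A' y F e xe => {n l y' F' e'}
    [n l y' F' e' x' Xx' xe' y F e xe|n l y' F' e1 e0 _ IH1 _ IH0 y F e].
    apply: approx_leaf (XG Xx Xx') _; apply: le_trans (leaf_dist2 _ _ _ _ _ Xx Xx') _.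
    by rewrite lerD// ler_wpM2l.
  rewrite (leaf_distD l (u_ n)) => xe.
  (* [e2] is the exact error on the right half; the remainder of [e] goes to the left half. *)
  set e2 := leaf_dist (right l (u_ n)) y F x in xe.
  have -> : a * e + (e1 + e0) = (a * e2 + e1) + (a * (e - e2) + e0) by lra.
  by apply: approx_node; [apply: IH1|apply: IH0; lra].
move=> /approx_down[e1' [e0' [-> A1' A0']]].
have -> : a * (e1 + e0) + (e1' + e0') = (a * e1 + e1') + (a * e0 + e0') by lra.
by apply: approx_node; [apply: IH1|apply: IH0].
Qed.

End approx2.

Lemma approxZD n l (a : R) y F e y' F' e' :
  tree_approx n l y F e -> tree_approx n l y' F' e' ->
  tree_approx n l (a *: y + y') (a *: F + F') (`|a| * e + e').
Proof.
apply: (approx2 (G := fun x x' => a *: x + x') (H := fun x x' => a *: x + x')) => //.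
- by move=> x x' Xx Xx'; have [_ XD _ _] := sX; exact: XD.
- by move=> x x' Xx Xx'; exact: lattice_homZD Xx Xx'.
- by move=> *; exact: vabsDZ.
- by move=> *; exact: vabsDZ.
Qed.

Lemma approx_sup n l y F e y' F' e' : tree_approx n l y F e -> tree_approx n l y' F' e' ->
  tree_approx n l (vsup y y') (vsup F F') (e + e').
Proof.
rewrite -[e in e + _]mul1r; apply: approx2 => //.
- by move=> x x' Xx Xx'; have [_ _ XU _] := sX; exact: XU.
- by move=> x x' Xx Xx'; have [_ TU _ _] := hT; exact: TU.
- by move=> *; rewrite scale1r; exact: vabs_sup.
- by move=> *; rewrite scale1r; exact: vabs_sup.
Qed.

(** On a leaf labelled [x], compatibility identifies [leaf_fun l (vabs x)] with the integral of
    [vabs (T x)]. At the root this makes the correspondence between [y] and [F] isometric up to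
    [e]. *)
Lemma approx_norm n l y F e : tree_approx n l y F e ->
  `|leaf_fun l (vabs y) - on l (vabs F)| <= e.
Proof.
elim=> {n l y F e} [n l y F e x Xx|n l y F e1 e0 _ IH1 _ IH0].
  rewrite /leaf_dist.
  have := positive_fun_dist y x (pfun l); have := positive_fun_dist F (T x) (pon l).
  rewrite (leaf_compat l (sublattice_abs sX Xx)) (lattice_hom_abs sX hT)//.
  rewrite !ler_norml => /andP[h1 h2] /andP[h3 h4] h5; apply/andP; split; lra.
rewrite (leaf_funD l (u_ n)) (onD l (u_ n)).
move: IH1 IH0; rewrite !ler_norml => /andP[h1 h2] /andP[h3 h4].
by apply/andP; split; lra.
Qed.

(** The tree and its labels are kept; the triangle inequality is applied on each leaf, and the
    corrections add up along the splits. *)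
Lemma approx_shift n l y F y' F' e : tree_approx n l y F e ->
  tree_approx n l y' F' (e + leaf_fun l (vabs (y' - y)) + on l (vabs (F' - F))).
Proof.
elim=> {n l y F e} [n l y F e x Xx|n l y F e1 e0 _ IH1 _ IH0].
  rewrite /leaf_dist => xe; apply: approx_leaf Xx _; rewrite /leaf_dist.
  have := positive_fun_le (pfun l) (vabsD (y' - y) (y - x)).
  have := positive_fun_le (pon l) (vabsD (F' - F) (F - T x)).
  rewrite (linear_funD (pfun l).1) (linear_funD (pon l).1) !subrKA => h1 h2.
  by lra.
rewrite (leaf_funD l (u_ n)) (onD l (u_ n)).
set t1 := leaf_fun (right l (u_ n)) _; set t0 := leaf_fun (left l (u_ n)) _.
set s1 := on (right l (u_ n)) _; set s0 := on (left l (u_ n)) _.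
have -> : e1 + e0 + (t0 + t1) + (s0 + s1) = (e1 + t1 + s1) + (e0 + t0 + s0) by lra.
exact: approx_node.
Qed.

Lemma approx_glue n l y F1 F0 e1 e0 :
  tree_approx n.+1 (right l (u_ n)) y F1 e1 -> tree_approx n.+1 (left l (u_ n)) y F0 e0 ->
  exists F, tree_approx n l y F (e1 + e0).
Proof.
move=> A1 A0; have [_ [s1 s0] _ _] := splitP l (u_ n).
have [F [F1E F0E]] := L1_glue F1 F0 (leaf_measurable l)
  (leaf_measurable (right l (u_ n))) s1.
rewrite -s0 in F0E.
exists F; apply: approx_node.
  by have := approx_shift y F A1; rewrite F1E subrr vabs0 (linear_fun0 (pfun _).1) !addr0.
by have := approx_shift y F A0; rewrite F0E subrr vabs0 (linear_fun0 (pfun _).1) !addr0.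
Qed.

Variable root : leaf.

Inductive node : nat -> leaf -> Prop :=
| node_root : node 0 root
| node_right n l : node n l -> node n.+1 (right l (u_ n))
| node_left n l : node n l -> node n.+1 (left l (u_ n)).

(** The split along [u_ i] kills one of the two parts of [u_ i], which stays killed further down
    because the functionals only decrease. *)
Lemma node_signs n l i : node n l -> (i < n)%N ->
  leaf_fun l (vpos (u_ i)) = 0 \/ leaf_fun l (vpos (- u_ i)) = 0.
Proof.
have small (k k' : leaf) y : (forall z, vle 0 z -> leaf_fun k z <= leaf_fun k' z) ->
    leaf_fun k' (vpos y) = 0 -> leaf_fun k (vpos y) = 0.
  move=> kk' k'y; apply/le_anti; rewrite (pfun k).2 ?vpos_ge0// andbT -k'y.
  exact/kk'/vpos_ge0.
have R_le k u z : vle 0 z -> leaf_fun (right k u) z <= leaf_fun k z.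
  by move=> z0; rewrite (leaf_funD k u) lerDr (pfun _).2.
have L_le k u z : vle 0 z -> leaf_fun (left k u) z <= leaf_fun k z.
  by move=> z0; rewrite (leaf_funD k u) lerDl (pfun _).2.
elim=> {n l} [//|n l _ IH|n l _ IH]; rewrite ltnS leq_eqVlt => /predU1P[->|/IH[|]].
- by right; have [] := splitP l (u_ n).
- by left; apply: small (R_le _ _) _.
- by right; apply: small (R_le _ _) _.
- by left; have [] := splitP l (u_ n).
- by left; apply: small (L_le _ _) _.
- by right; apply: small (L_le _ _) _.
Qed.

(** Starting from [T x] on the nodes of depth [n], [F] is glued together on the way up to the root.
    Bounding the errors by values at a fixed [w] makes them add up to [leaf_fun root w], however
    many nodes there are. *)
Lemma approx_level n y w :
  (forall l, node n l -> exists2 x, X x & leaf_fun l (vabs (y - x)) <= leaf_fun l w) ->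
  exists F, tree_approx 0 root y F (leaf_fun root w).
Proof.
(* The induction is on the number [k] of levels left below the node. *)
move=> Hn; suff H k l : (k <= n)%N -> node (n - k) l ->
    exists F, tree_approx (n - k) l y F (leaf_fun l w).
  by have := H n root (leqnn n); rewrite subnn => /(_ node_root).
elim: k l => [|k IH] l kn.
  rewrite subn0 => /Hn[x Xx xw]; exists (T x); apply: approx_leaf Xx _.
  by rewrite /leaf_dist subrr vabs0 (linear_fun0 (pon _).1) addr0.
move=> nl; move: IH; rewrite -(subnSK kn) => IH.
have [F1 A1] := IH _ (ltnW kn) (node_right nl).
have [F0 A0] := IH _ (ltnW kn) (node_left nl).
by rewrite (leaf_funD l (u_ (n - k.+1))) addrC; exact: approx_glue A1 A0.
Qed.

End tree.

(** * Approximation of positive elements by grids of multiples of the majorants *)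

Section grid.
Variables (R : realType) (I : Type) (mu : {measure set (cube R I) -> \bar R}).
Local Notation L1 := (LspaceType1 mu).
Variables (Y : banachLatticeType R) (X : set Y) (T : Y -> L1).
Hypothesis sX : sublattice X.
Local Notation leaf := (leaf X T).
Variables (right left : leaf -> Y -> leaf).
Hypothesis splitP : forall l u,
  [/\ forall y, leaf_fun l y = leaf_fun (left l u) y + leaf_fun (right l u) y,
      leaf_set (right l u) `<=` leaf_set l /\
      leaf_set (left l u) = leaf_set l `\` leaf_set (right l u),
      leaf_fun (right l u) (vpos (- u)) = 0 & leaf_fun (left l u) (vpos u) = 0].
Variables (v_ E : nat -> Y).
Hypothesis v_ge0 : forall k, vle 0 (v_ k).
Hypothesis E_ge0 : forall m, vle 0 (E m).
Hypothesis XE : forall m, X (E m).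

(** Pickling arranges all these differences in a single sequence along which the tree is split;
    splitting along the default 0 does no harm. *)
Definition grid n : Y :=
  if unpickle n is Some (k, a, b, m) then v_ k - (a%:R / b.+1%:R) *: E m else 0.

Lemma gridE k a b m : grid (pickle (k, a, b, m)) = v_ k - (a%:R / b.+1%:R) *: E m.
Proof. by rewrite /grid pickleK. Qed.

(* On each node deep enough, the sign of every [v_ k - (i / b.+1) *: E m] with
   [i <= b.+1] is decided, which locates [v_ k] in an interval of length
   [b.+1%:R^-1 *: E m]. *)
Lemma grid_level (l : leaf) k b m :
  (forall i, (i <= b.+1)%N -> leaf_fun l (vpos (v_ k - (i%:R / b.+1%:R) *: E m)) = 0 \/
    leaf_fun l (vpos (- (v_ k - (i%:R / b.+1%:R) *: E m))) = 0) ->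
  exists2 x, X x & leaf_fun l (vabs (v_ k - x)) <=
    leaf_fun l (b.+1%:R^-1 *: E m + vpos (v_ k - E m)).
Proof.
pose t i : R := i%:R / b.+1%:R; pose z i := v_ k - t i *: E m.
move=> sgn; have pl := leaf_positive l.
have absE y : leaf_fun l (vabs y) <= leaf_fun l (vpos y) + leaf_fun l (vpos (- y)).
  by rewrite -(linear_funD pl.1); apply: positive_fun_le => //; exact: vabs_le_pos.
have t1 : t b.+1 = 1 by rewrite /t divff.
have [[i0 /andP[ib zi]]|nz] :=
    pselect (exists i, (i <= b.+1)%N && (leaf_fun l (vpos (z i)) == 0)); last first.
  (* Here [v_ k] lies above [E m] as far as the node can see, so the label is [E m] and the error is
     the excess. *)
  exists (E m) => //; have [z0|z0] := sgn b.+1 (leqnn _).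
    by case: nz; exists b.+1; rewrite leqnn z0 eqxx.
  rewrite -/(t _) t1 scale1r in z0; apply: le_trans (absE _) _.
  rewrite z0 addr0; apply: positive_fun_le => //.
  rewrite -[X in vle X _]add0r; apply: vleD; last exact: vlexx.
  by apply: vscaler_ge0 => //; rewrite invr_ge0.
have exi : exists i, leaf_fun l (vpos (z i)) == 0 by exists i0.
have rhs0 : 0 <= leaf_fun l (vpos (v_ k - E m)) by exact/pl.2/vpos_ge0.
rewrite (linear_funD pl.1) (linear_funZ pl.1).
have E0 : 0 <= b.+1%:R^-1 * leaf_fun l (E m) by rewrite mulr_ge0 ?invr_ge0// pl.2.
(* The least such [i] locates [v_ k]: if it is 0, the functional vanishes at [v_ k]; otherwise
   minimality and the sign at [j] put [v_ k] between two consecutive multiples of [E m]. *)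
case: (ex_minnP exi) => -[|j] /eqP zj jmin.
  exists 0; first exact: sublattice0.
  rewrite subr0 vabs_id//.
  have -> : leaf_fun l (v_ k) = 0.
    by move: zj; rewrite /z /t mul0r scale0r subr0 vpos_id.
  by rewrite addr_ge0.
have jb : (j <= b.+1)%N by rewrite (leq_trans (leqnSn j))// (leq_trans (jmin _ zi)).
exists (t j *: E m); first exact: sublatticeZ.
apply: le_trans (absE _) _.
have [zj0|->] := sgn j jb.
  by have := jmin j (introT eqP zj0); rewrite ltnn.
rewrite addr0; apply: (@le_trans _ _ (leaf_fun l (vpos (z j.+1) + b.+1%:R^-1 *: E m))).
  apply: positive_fun_le => //.
  have -> : v_ k - t j *: E m = z j.+1 + b.+1%:R^-1 *: E m.
    have -> : t j = t j.+1 - b.+1%:R^-1 by rewrite /t -[j.+1%:R]natr1 mulrDl mul1r addrK.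
    by rewrite /z scalerBl opprB addrA addrAC.
  apply: vle_le_trans (vposD_le _ _) _; apply: vleD; first exact: vlexx.
  by rewrite vpos_id ?vlexx//; apply: vscaler_ge0 => //; rewrite invr_ge0.
by rewrite (linear_funD pl.1) zj (linear_funZ pl.1) add0r lerDl.
Qed.

(** First [m] is chosen to make the excess over [E m] small, then [b] to make the mesh small, and
    finally a depth at which all signs on that grid are decided. *)
Lemma grid_approx (root : leaf) k (e : R) : 0 < e ->
  (forall e : R, 0 < e -> exists m, leaf_fun root (vpos (v_ k - E m)) < e) ->
  exists F, tree_approx right left grid 0 root (v_ k) F e.
Proof.
move=> e0 small; have e20 : 0 < e / 2 by rewrite divr_gt0.
have [m me] := small _ e20.
have pr := leaf_positive root.
have Er : 0 <= leaf_fun root (E m) by exact: pr.2.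
have [b be] : exists b, b.+1%:R^-1 * leaf_fun root (E m) < e / 2.
  have d0 : 0 < e / 2 / (leaf_fun root (E m) + 1) by rewrite !divr_gt0// ltr_wpDl.
  have /filter_ex[b /= bd] := near_infty_natSinv_lt (PosNum d0); exists b.
  apply: (@le_lt_trans _ _ (b.+1%:R^-1 * (leaf_fun root (E m) + 1))).
    by rewrite ler_wpM2l ?invr_ge0// lerDl.
  by rewrite -ltr_pdivlMr// ltr_wpDl.
(* [b.+2] counts the grid indices up to [b.+1]; the successor is there because [node_signs] wants an
   index strictly below the depth. *)
pose n := \max_(i < b.+2) (pickle (k, nat_of_ord i, b, m)).+1.
have [F HF] : exists F, tree_approx right left grid 0 root (v_ k) F
    (leaf_fun root (b.+1%:R^-1 *: E m + vpos (v_ k - E m))).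
  apply: (approx_level splitP (n := n)) => l nl; apply: grid_level => i ib.
  rewrite -gridE; apply: (node_signs splitP nl).
  exact: (@leq_bigmax _ (fun i : 'I_b.+2 => (pickle (k, nat_of_ord i, b, m)).+1)
    (Ordinal (ib : (i < b.+2)%N))).
exists F; apply: approx_le HF _.
rewrite (linear_funD pr.1) (linear_funZ pr.1) [leRHS]splitr; exact: ltW (ltrD be me).
Qed.

End grid.

(** * The operator norm and the extension *)

Section op_norm.
Variables (R : realType) (Y Z : banachLatticeType R) (X : set Y) (T : Y -> Z).
Hypothesis sX : sublattice X.
Hypothesis hT : lattice_hom X T.

(** The supremum is nonnegative because the unit ball of [X] contains 0, and finite because [T] is
    bounded; rescaling turns it into a bound on all of [X]. *)
Lemma op_normP : exists2 C : R, 0 <= C &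
  (forall x, X x -> `|T x| <= C * `|x|) /\ op_norm X T = C%:E.
Proof.
have [_ _ _ [M TM]] := hT.
have op_ub x : X x -> `|x| <= 1 -> (`|T x|%:E <= op_norm X T)%E.
  by move=> Xx x1; apply: ereal_sup_ubound; exists x.
have op_ge0 : (0 <= op_norm X T)%E.
  have := op_ub _ (sublattice0 sX); rewrite (lattice_hom0 sX hT) !normr0; exact.
have op_fin : op_norm X T \is a fin_num.
  rewrite ge0_fin_numE//; apply: (@le_lt_trans _ _ (`|M|%:E)); last exact: ltry.
  apply: ge_ereal_sup => _ [x [Xx x1] <-]; rewrite lee_fin.
  apply: le_trans (TM _ Xx) _; apply: le_trans (ler_wpM2r (normr_ge0 _) (ler_norm M)) _.
  by rewrite ler_piMr.
exists (fine (op_norm X T)); first exact: fine_ge0.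
split; last by rewrite fineK.
move=> x Xx; have [->|x0] := eqVneq x 0.
  by rewrite (lattice_hom0 sX hT) !normr0 mulr0.
have nx : 0 < `|x| by rewrite normr_gt0.
have := op_ub _ (sublatticeZ sX `|x|^-1 Xx).
rewrite normrZ normfV normr_id mulVf ?gt_eqF// => /(_ (lexx _)).
rewrite -[op_norm X T]fineK// lee_fin (lattice_homZ sX hT)// normrZ normfV normr_id.
by rewrite ler_pdivrMl// mulrC.
Qed.

End op_norm.

Theorem theorem6p5 (R : realType) (I : Type)
    (I_uncountable : ~ countable [set: I])
    (mu : {measure set (cube R I) -> \bar R})
    (mu_product : is_product_lebesgue mu) :
  one_separably_BL_injective (LspaceType1 mu).
Proof.
move=> Y sepY X sX _ T hT.
have [C C0 [TC opC]] := op_normP sX hT.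
have [d_ d_dense] := separable_dense_seq sepY.
have [x_ Xx_ x_dense] := separable_dense_seq_sub sepY (sublattice0 sX).
have pI := integral_on_positive mu (@measurableT _ (cube R I)).
pose tau x := integral_on setT (T x).
have tauD a x y : X x -> X y -> tau (a *: x + y) = a * tau x + tau y.
  by move=> Xx Xy; rewrite /tau (lattice_homZD hT)// pI.1.
have tau_pos x : X x -> tau x <= tau (vpos x).
  move=> Xx; rewrite /tau (lattice_hom_pos sX hT)//.
  by apply: positive_fun_le => //; exact: vle_vpos.
have tau_le x : X x -> tau x <= C * `|x|.
  move=> Xx; apply: le_trans (ler_norm _) _; apply: le_trans (positive_fun_abs pI _) _.
  by rewrite -L1_norm_integral; exact: TC.
have [psi ppsi [psiX psi_le psiE]] := band_functional sX C0 tauD tau_pos tau_le x_dense.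
pose root : leaf X T := Leaf ppsi measurableT psiX.
have split_ex (lu : leaf X T * Y) := leaf_split mu_product I_uncountable sX hT C0 TC
  Xx_ x_dense lu.1 lu.2.
have /choice[r /choice[s rs]] := split_ex.
pose right l u := r (l, u); pose left l u := s (l, u).
have splitP l u : [/\
      forall y, leaf_fun l y = leaf_fun (left l u) y + leaf_fun (right l u) y,
      leaf_set (right l u) `<=` leaf_set l /\
      leaf_set (left l u) = leaf_set l `\` leaf_set (right l u),
      leaf_fun (right l u) (vpos (- u)) = 0 & leaf_fun (left l u) (vpos u) = 0].
  exact: (rs (l, u)).
pose v_ k := vpos (d_ k); pose E := majorants x_; pose u_ := grid v_ E.
(* [rep y F] will characterise [F] as the value of the extension at [y]: to every precision, some
   tree approximates both. *)
pose rep y F := forall e : R, 0 < e -> tree_approx right left u_ 0 root y F e.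
have approx_pos y : vle 0 y -> forall e : R, 0 < e ->
    exists F, tree_approx right left u_ 0 root y F e.
  move=> y0 e e0; have e20 : 0 < e / 2 by rewrite divr_gt0.
  (* Half of [e] pays for approximating [v_ k], half for replacing [v_ k] by [y]; [C + 1] avoids
     dividing by 0. *)
  have d0 : 0 < e / 2 / (C + 1) by rewrite !divr_gt0// ltr_wpDl.
  have [k yk] := d_dense y _ d0.
  have [F HF] := grid_approx sX splitP (v_ := v_) (E := E)
    (fun k => vpos_ge0 (d_ k)) (majorants_ge0 x_) (majorants_sub sX Xx_) (root := root) (k := k) e20
    (fun e' => psiE (v_ k) e' (vpos_ge0 (d_ k))).
  exists F; apply: (approx_le (approx_shift splitP y F HF)).
  rewrite subrr vabs0 (linear_fun0 pI.1) addr0 [leRHS]splitr lerD2l /=.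
  apply: le_trans (psi_le _ (vabs_ge0 _)) _; rewrite norm_vabs.
  have : `|y - v_ k| <= `|y - d_ k| by rewrite -{1}(vpos_id y0); exact: norm_vpos_sub.
  move=> h; apply: (@le_trans _ _ ((C + 1) * `|y - d_ k|)).
    by apply: ler_pM => //; rewrite lerDl.
  by rewrite mulrC -ler_pdivlMr ?ltr_wpDl// ltW.
have approx_ex y (e : R) : 0 < e -> exists F, tree_approx right left u_ 0 root y F e.
  move=> e0; have e20 : 0 < e / 2 by rewrite divr_gt0.
  have [F1 A1] := approx_pos _ (vpos_ge0 y) _ e20.
  have [F2 A2] := approx_pos _ (vpos_ge0 (- y)) _ e20.
  exists (-1 *: F2 + F1); have := approxZD sX hT splitP (-1) A2 A1.
  by rewrite scaleN1r [- _ + _]addrC -vposB normrN1 mul1r -splitr.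
have rep_norm y F (e : R) : tree_approx right left u_ 0 root y F e ->
    `|psi (vabs y) - `|F| | <= e.
  by move=> /(approx_norm sX hT splitP); rewrite -L1_norm_integral.
(* The difference of [F'] and [F] is an approximation for 0, where [psi] vanishes, so the
   near-isometry bounds its norm. *)
have rep_dist y F F' (e e' : R) : tree_approx right left u_ 0 root y F e ->
    tree_approx right left u_ 0 root y F' e' -> `|F' - F| <= e + e'.
  move=> A A'; have /rep_norm := approxZD sX hT splitP (-1) A A'.
  rewrite !scaleN1r addNr vabs0 (linear_fun0 ppsi.1) sub0r normrN normr_id normrN1 mul1r.
  by rewrite addrC.
have rep_uniq y F F' : rep y F -> rep y F' -> F = F'.
  move=> H H'; apply/esym/eqP; rewrite -subr_eq0 -normr_le0; apply/ler_addgt0Pr => e e0.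
  have e20 : 0 < e / 2 by rewrite divr_gt0.
  by rewrite add0r [leRHS]splitr; exact: rep_dist (H _ e20) (H' _ e20).
(* Approximants with error [1 / (n + 1)] form a Cauchy sequence by [rep_dist], and by [approx_shift]
   their limit represents [y]. *)
have /choice[T' T'P] y : exists F, rep y F.
  have inv0 n : 0 < n.+1%:R^-1 :> R by rewrite invr_gt0.
  have /choice[F_ HF] n := approx_ex y _ (inv0 n).
  have cF : cvg (F_ @ \oo).
    apply/cauchy_cvgP/cauchy_exP => e e0.
    have e20 : 0 < e / 2 by rewrite divr_gt0.
    have [N _ HN] := near_infty_natSinv_lt (PosNum e20).
    exists (F_ N); exists N => // n /= Nn; rewrite -ball_normE /=.
    apply: le_lt_trans (rep_dist _ _ _ _ _ (HF n) (HF N)) _.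
    by rewrite [ltRHS]splitr ltrD//; apply: HN => /=.
  exists (limn F_) => e e0; have e20 : 0 < e / 2 by rewrite divr_gt0.
  have /cvgrPdist_lt/(_ _ e20) Fe := cF.
  have [n [/= n1 n2]] := filter_ex (filterI (near_infty_natSinv_lt (PosNum e20)) Fe).
  apply: (approx_le (approx_shift splitP y (limn F_) (HF n))).
  rewrite subrr vabs0 (linear_fun0 (leaf_positive root).1) addr0 -L1_norm_integral.
  by rewrite [leRHS]splitr lerD// ltW.
have T'D a y y' : T' (a *: y + y') = a *: T' y + T' y'.
  apply: rep_uniq (T'P _) _ => e e0.
  have a1 : 0 < `|a| + 1 by rewrite ltr_wpDl.
  have e1 : 0 < e / (`|a| + 1) by rewrite divr_gt0.
  have := approxZD sX hT splitP a (T'P y _ e1) (T'P y' _ e1).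
  suff -> : `|a| * (e / (`|a| + 1)) + e / (`|a| + 1) = e by [].
  rewrite -[X in _ * _ + X]mul1r -mulrDl mulrC divfK//; exact: lt0r_neq0.
have T'U y y' : T' (vsup y y') = vsup (T' y) (T' y').
  apply: rep_uniq (T'P _) _ => e e0; have e20 : 0 < e / 2 by rewrite divr_gt0.
  by have := approx_sup sX hT splitP (T'P y _ e20) (T'P y' _ e20); rewrite -splitr.
(* Up to [e], the norm of [T' y] is [psi (vabs y)]. *)
have T'C y : `|T' y| <= C * `|y|.
  apply/ler_addgt0Pr => e e0; have := rep_norm _ _ _ (T'P y _ e0).
  have := psi_le _ (vabs_ge0 y); rewrite norm_vabs ler_norml => h /andP[h1 h2]; lra.
exists T'; split.
- split=> [a x y _ _|x y _ _|x y _ _|]; first exact: T'D.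
  + exact: T'U.
  + have T'N z : T' (- z) = - T' z.
      have T'0 : T' 0 = 0.
        have := T'D 1 0 0; rewrite !scale1r addr0 => /eqP.
        by rewrite eq_sym -subr_eq0 addrK => /eqP.
      by have := T'D (-1) z 0; rewrite T'0 !addr0 !scaleN1r.
    have T'A z z' : T' (z + z') = T' z + T' z'.
      by have := T'D 1 z z'; rewrite !scale1r.
    by rewrite !vinfE !T'A T'N T'U.
  + by exists C => x _; exact: T'C.
- move=> x Xx; apply: rep_uniq (T'P x) _ => e e0.
  (* The root alone, labelled [x], is an exact tree for [x] and [T x]. *)
  apply: approx_leaf Xx _; rewrite /leaf_dist !subrr !vabs0.
  by rewrite (linear_fun0 (leaf_positive root).1) (linear_fun0 pI.1) addr0 ltW.
- rewrite opC; apply: ge_ereal_sup => _ [y [_ y1] <-]; rewrite lee_fin.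
  by apply: le_trans (T'C y) _; rewrite ler_piMr.
Qed.
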